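(* Let $(F_n)_{n\in\mathbb{N}}$ be a sequence of quasi-infinitely divisible distribution functions with spectral pairs $(\gamma_n,G_n)$, $\gamma_n\in\mathbb{R}$, $G_n\in\boldsymbol{V}$, $n\in\mathbb{N}$. Suppose that $\varlimsup_{n\to\infty}\|G_n\|<\infty$. If $(F_n)_{n\in\mathbb{N}}$ is relatively compact and $\gamma_n\to\gamma$, $G_n\Rightarrow G$ (basic convergence), $n\to\infty$, with some $\gamma\in\mathbb{R}$ and $G\in\boldsymbol{V}$, then $(\gamma,G)$ is the spectral pair for a quasi-infinitely divisible distribution function $F$ and the sequence $(F_n)_{n\in\mathbb{N}}$ weakly converges to $F$.
   Context: $\boldsymbol{V}$ denotes the class of all functions $G:\mathbb{R}\to\mathbb{R}$ of bounded variation on $\mathbb{R}$ that are right-continuous at every point and satisfy $G(-\infty)=0$, where $G(\pm\infty)$ denote the limits at $\pm\infty$. For $G\in\boldsymbol{V}$, $\|G\|$ is the total variation of $G$ on $\mathbb{R}$; integrals $\int_{\mathbb{R}} h\,dG$ are with respect to the finite signed Lebesgue--Stieltjes measure $\mu_G$ with $\mu_G((a,b])=G(b)-G(a)$. A number $\tau>0$ is fixed throughout. A (probability) distribution function $F$ on $\mathbb{R}$ is quasi-infinitely divisible if its characteristic function $f(t)=\int_{\mathbb{R}}e^{itx}\,dF(x)$ has the form $$f(t)=\exp\Bigl\{it\gamma+\int_{\mathbb{R}}\Bigl(e^{itx}-1-\tfrac{it}{\tau}\sin(\tau x)\Bigr)\tfrac{1+x^2}{x^2}\,dG(x)\Bigr\},\quad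 t\in\mathbb{R},$$ with some $\gamma\in\mathbb{R}$ and $G\in\boldsymbol{V}$ (the integrand at $x=0$ is defined by continuity, i.e. equals $-t^2/2$). The pair $(\gamma,G)$ is uniquely determined by $F$ and is called its spectral pair. (The property does not depend on $\tau$; $\gamma$ depends on $\tau$ but $G$ does not. All spectral pairs are taken with the same fixed $\tau$.) Basic convergence: for $G_n,G\in\boldsymbol{V}$, $(G_n)_{n\in\mathbb{N}}$ converges basically to $G$, written $G_n\Rightarrow G$, $n\to\infty$, if every subsequence of $(G_n)_{n\in\mathbb{N}}$ contains a further subsequence $(G_{n_k})_{k\in\mathbb{N}}$ for which there is an at most countable set $D\subset\mathbb{R}$ (depending in general on the choice of the subsequences) such that $G_{n_k}(x_2)-G_{n_k}(x_1)\to G(x_2)-G(x_1)$, $k\to\infty$, for all $x_1,x_2\in\mathbb{R}\setminus D$. Weak convergence of $(F_n)$ to $F$ means $\int_{\mathbb{R}}h\,dF_n\to\int_{\mathbb{R}}h\,dF$ for every bounded continuous $h:\mathbb{R}\to\mathbb{R}$. A sequence $(F_n)_{n\in\mathbb{N}}$ of distribution functions is relatively compact if every subsequence contains a further subsequence that weakly converges to a distribution function. *)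

(* Defs.v *)
From HB Require Import structures.
From mathcomp Require Import all_boot all_order all_algebra.
From mathcomp Require Import all_classical all_reals all_analysis.
From mathcomp Require Import complex.

Set Implicit Arguments.
Unset Strict Implicit.
Unset Printing Implicit Defensive.

Import Order.TTheory GRing.Theory Num.Theory.
Import numFieldNormedType.Exports.

Local Open Scope classical_set_scope.
Local Open Scope ring_scope.
Local Open Scope complex_scope.

(* Distribution functions are terms F : cumulativeBounded 0 1: nondecreasing,
   right-continuous, with limits 0 at -oo and 1 at +oo; dF is integration
   against lebesgue_stieltjes_measure F. *)

Section functions_of_bounded_variation.
Context {R : realType}.
Implicit Types G : R -> R.

Definition total_variation_line G : \bar R :=
  ereal_sup [set total_variation ab.1 ab.2 G | ab in [set ab | ab.1 < ab.2]].

Definition class_V G : Prop :=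
  [/\ (total_variation_line G < +oo)%E, right_continuous G
    & G x @[x --> -oo] --> 0].

(* A charge is a finite signed measure. These values on half-open intervals
   determine it on the Borel sets, and it exists for every G in V. *)
Definition is_stieltjes_charge G
    (mu : {charge set (measurableTypeR R) -> \bar R}) : Prop :=
  forall a b : R, a <= b -> mu `]a, b]%classic = (G b - G a)%:E.

Definition increasing_indices (phi : nat -> nat) : Prop :=
  {homo phi : m n / (m < n)%N}.

Definition basic_cvg (Gn : nat -> R -> R) (G : R -> R) : Prop :=
  forall phi, increasing_indices phi ->
  exists2 psi, increasing_indices psi &
  exists2 D : set R, countable D &
    forall x1 x2 : R, ~ D x1 -> ~ D x2 ->
      Gn (phi (psi k)) x2 - Gn (phi (psi k)) x1 @[k --> \oo] --> G x2 - G x1.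

End functions_of_bounded_variation.

Section signed_integral.
Context d (T : measurableType d) (R : realType).
Variable nu : {charge set T -> \bar R}.

(* The integrals below do not depend on the Hahn decomposition chosen here. *)
Let hahnP := cid (Hahn_decomposition nu).
Let hahnN := cid (projT2 hahnP).

Definition charge_Rintegral (h : T -> R) : R :=
  Rintegral (jordan_pos (projT2 hahnN)) setT h
  - Rintegral (jordan_neg (projT2 hahnN)) setT h.

Definition charge_Cintegral (h : T -> R[i]) : R[i] :=
  charge_Rintegral (fun x => complex.Re (h x))
  +i* charge_Rintegral (fun x => complex.Im (h x)).

End signed_integral.

Section quasi_infinite_divisibility.
Context {R : realType}.
Implicit Types (F : cumulativeBounded (0 : R) (1 : R)) (G : R -> R).

Definition cexp (z : R[i]) : R[i] :=
  (expR (complex.Re z))%:C * (cos (complex.Im z) +i* sin (complex.Im z)).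

Definition Cintegral d (T : measurableType d)
    (mu : {measure set T -> \bar R}) (h : T -> R[i]) : R[i] :=
  Rintegral mu setT (fun x => complex.Re (h x))
  +i* Rintegral mu setT (fun x => complex.Im (h x)).

Definition char_fun F (t : R) : R[i] :=
  Cintegral (lebesgue_stieltjes_measure F) (fun x : R => cexp ((t * x) *i)).

(* The value at x = 0 is the continuous extension. *)
Definition spectral_kernel (tau t x : R) : R[i] :=
  if x == 0 then (- (t ^+ 2 / 2))%:C else
  (cexp ((t * x) *i) - 1 - (t / tau * sin (tau * x)) *i)
  * ((1 + x ^+ 2) / x ^+ 2)%:C.

Definition spectral_pair (tau : R) F (gamma : R) G : Prop :=
  class_V G /\
  exists2 mu : {charge set (measurableTypeR R) -> \bar R},
    is_stieltjes_charge G mu &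
    forall t : R, char_fun F t =
      cexp ((t * gamma) *i + charge_Cintegral mu (spectral_kernel tau t)).

Definition quasi_infinitely_divisible (tau : R) F : Prop :=
  exists gamma G, spectral_pair tau F gamma G.

Definition weak_cvg (Fn : nat -> cumulativeBounded (0 : R) (1 : R)) F : Prop :=
  forall h : R -> R, continuous h -> (exists M : R, forall x, `|h x| <= M) ->
    Rintegral (lebesgue_stieltjes_measure (Fn n)) setT h @[n --> \oo]
      --> Rintegral (lebesgue_stieltjes_measure F) setT h.

Definition relatively_compact
    (Fn : nat -> cumulativeBounded (0 : R) (1 : R)) : Prop :=
  forall phi, increasing_indices phi ->
  exists2 psi, increasing_indices psi &
  exists F, weak_cvg (fun k => Fn (phi (psi k))) F.

End quasi_infinite_divisibility.

(* Main.v *)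
Require Import Defs.
From HB Require Import structures.
From mathcomp Require Import all_boot all_order all_algebra.
From mathcomp Require Import all_classical all_reals all_analysis.
From mathcomp Require Import measurable_realfun complex.
From mathcomp Require Import ring lra.

Set Implicit Arguments.
Unset Strict Implicit.
Unset Printing Implicit Defensive.

Import Order.TTheory GRing.Theory Num.Theory.
Import numFieldNormedType.Exports.

Local Open Scope classical_set_scope.
Local Open Scope ring_scope.

(** The characteristic function of Fn n is exp (psi_n t) with
    psi_n t = i t gamman n + int k(t, x) dGn(x), where k is the spectral kernel with
    parts [re_kernel] and [im_kernel], and the logarithm psi_n is continuous in t.
    The point is to pass to the limit in the integral. Basic convergence is not
    sufficient for that, since k(t, x) does not vanish as x tends to infinity and
    the charges dGn are not assumed tight. The missing compactness comes from the
    laws Fn n themselves.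

    Along a subsequence Fn n converges weakly to some F. The increments of the
    characteristic functions over |t - s| <= d are at most the integrals of
    min (2, d |x|), which are small uniformly in large n because this is a bounded
    continuous function ([weak_cvg_equicontinuous]). Since the variations are
    bounded, |exp psi_n| is bounded below on compact sets, and a continuous
    logarithm inherits the equicontinuity ([polar_distance],
    [continuous_argument_small], [log_equicontinuous]).

    The normalisation of the kernel now enters through an identity
    ([re_kernel_cosM], [im_kernel_cosM]): multiplying k(t, x) by cos (a x) - 1 gives
    a combination of symmetric second differences in the variable t, taken at t and
    at 0 for the real part, at t and at tau for the imaginary part. By
    equicontinuity this modulation therefore changes int k(t, x) dGn(x) by little,
    uniformly in large n and small a. Averaging over 0 <= a <= d replaces k(t, x) by
    k(t, x) sinc (d x), which is continuous and vanishes at infinity; for such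
    functions basic convergence with bounded variations does give convergence of the
    integrals ([basic_cvg_charge_Rintegral]). Letting d tend to 0 under the limit
    charge, one finds that int k(t, x) dGn(x) tends to int k(t, x) dG(x)
    ([modulation_charge_Rintegral_cvg], [log_cvg]). As gamman n tends to gamma, F has
    the spectral pair (gamma, G).

    All subsequential limits thus share one characteristic function. They coincide:
    the integrals of polynomials in sin (x / N) are determined, hence by Bernstein
    approximation those of h (N sin (x / N)), and these tend to the integral of h
    ([eq_Rintegral_of_cos]). So the whole sequence converges weakly. *)

(** * Integration of bounded measurable functions *)

Section bounded_measurable.
Context d (T : measurableType d) (R : realType).
Implicit Types (g h : T -> R) (mu : {finite_measure set T -> \bar R}).

Definition bounded_measurable g :=
  measurable_fun setT g /\ exists M, forall x, `|g x| <= M.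

Lemma bounded_measurable_cst c : bounded_measurable (fun=> c).
Proof. by split; [exact: measurable_cst | exists `|c|]. Qed.

Lemma bounded_measurableD g h : bounded_measurable g -> bounded_measurable h ->
  bounded_measurable (fun x => g x + h x).
Proof.
move=> [mg [A gA]] [mh [B hB]]; split; first exact: measurable_funD.
by exists (A + B) => x; rewrite (le_trans (ler_normD _ _))// lerD.
Qed.

Lemma bounded_measurableM g h : bounded_measurable g -> bounded_measurable h ->
  bounded_measurable (fun x => g x * h x).
Proof.
move=> [mg [A gA]] [mh [B hB]]; split; first exact: measurable_funM.
by exists (A * B) => x; rewrite normrM ler_pM.
Qed.

Lemma bounded_measurableZ c g : bounded_measurable g ->
  bounded_measurable (fun x => c * g x).
Proof. by apply: bounded_measurableM; exact: bounded_measurable_cst. Qed.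

Lemma bounded_measurableB g h : bounded_measurable g -> bounded_measurable h ->
  bounded_measurable (fun x => g x - h x).
Proof.
move=> bg bh; have := bounded_measurableD bg (bounded_measurableZ (-1) bh).
by under eq_fun do rewrite mulN1r.
Qed.

Lemma bounded_measurable_sum (I : Type) (s : seq I) (g : I -> T -> R) :
  (forall i, bounded_measurable (g i)) ->
  bounded_measurable (fun x => \sum_(i <- s) g i x).
Proof.
move=> bg; elim: s => [|i s IHs].
  by under eq_fun do rewrite big_nil; exact: bounded_measurable_cst.
by under eq_fun do rewrite big_cons; exact: bounded_measurableD.
Qed.

Lemma bounded_measurable_indic (A : set T) :
  measurable A -> bounded_measurable (\1_A : T -> R).
Proof.
move=> mA; split; first exact: measurable_indic.
by exists 1 => x; rewrite indicE; case: (_ \in _); rewrite ?normr1 ?normr0.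
Qed.

Lemma bounded_measurable_integrable mu g :
  bounded_measurable g -> mu.-integrable setT (EFin \o g).
Proof.
move=> [mg [M gM]]; apply: measurable_bounded_integrable => //.
  by rewrite ltey_eq fin_num_measure.
by exists M; split; [exact: num_real|move=> y My x _ /=; exact: le_trans (ltW My)].
Qed.

Lemma bounded_RintegralD mu g h : bounded_measurable g -> bounded_measurable h ->
  Rintegral mu setT (fun x => g x + h x)
  = Rintegral mu setT g + Rintegral mu setT h.
Proof.
by move=> bg bh; rewrite RintegralD//; exact: bounded_measurable_integrable.
Qed.

Lemma bounded_RintegralZ mu c g : bounded_measurable g ->
  Rintegral mu setT (fun x => c * g x) = c * Rintegral mu setT g.
Proof.
by move=> bg; rewrite RintegralZl//; exact: bounded_measurable_integrable.
Qed.

Lemma bounded_RintegralB mu g h : bounded_measurable g -> bounded_measurable h ->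
  Rintegral mu setT (fun x => g x - h x)
  = Rintegral mu setT g - Rintegral mu setT h.
Proof.
by move=> bg bh; rewrite RintegralB//; exact: bounded_measurable_integrable.
Qed.

Lemma bounded_le_Rintegral mu g h : bounded_measurable g -> bounded_measurable h ->
  (forall x, g x <= h x) -> Rintegral mu setT g <= Rintegral mu setT h.
Proof.
by move=> bg bh gh; apply: le_Rintegral => //; exact: bounded_measurable_integrable.
Qed.

Lemma bounded_le_norm_Rintegral mu g h :
  bounded_measurable g -> bounded_measurable h ->
  (forall x, `|g x| <= h x) -> `|Rintegral mu setT g| <= Rintegral mu setT h.
Proof.
move=> bg bh gh; rewrite ler_norml; apply/andP; split; last first.
  by apply: bounded_le_Rintegral => // x; exact: le_trans (ler_norm _) (gh x).
rewrite -[leLHS]mulN1r -bounded_RintegralZ//; apply: bounded_le_Rintegral => //.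
  exact: bounded_measurableZ.
by move=> x; rewrite mulN1r lerNl (le_trans _ (gh x))// -normrN ler_norm.
Qed.

Lemma norm_Rintegral_le_mass mu g M :
  bounded_measurable g -> (forall x, `|g x| <= M) ->
  `|Rintegral mu setT g| <= M * fine (mu setT).
Proof.
move=> bg gM; rewrite -Rintegral_cst//; apply: bounded_le_norm_Rintegral => //.
exact: bounded_measurable_cst.
Qed.

Lemma bounded_Rintegral_cvg mu (g_ : nat -> T -> R) g M :
  (forall n, measurable_fun setT (g_ n)) -> measurable_fun setT g ->
  (forall n x, `|g_ n x| <= M) ->
  (forall x, g_ n x @[n --> \oo] --> g x) ->
  Rintegral mu setT (g_ n) @[n --> \oo] --> Rintegral mu setT g.
Proof.
move=> mg_ mg gM cg.
have [|||||_ _] := @dominated_convergence _ _ _ mu setT measurableT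
  (fun n => EFin \o g_ n) (EFin \o g) (cst M%:E).
- by move=> n; exact/measurable_EFinP.
- exact/measurable_EFinP.
- by apply: aeW => x _; apply/cvg_EFin; [exact: nearW|exact: cg].
- have := bounded_measurable_integrable mu (bounded_measurable_cst M).
  by apply: eq_integrable => //.
- by apply: aeW => x n _ /=; rewrite lee_fin.
move=> c; apply: fine_cvg => //; rewrite fineK//.
apply: integrable_fin_num => //; apply: bounded_measurable_integrable.
split=> //; exists M => x; move/cvg_norm: (cg x) => /cvg_lim <-//.
by apply: limr_le; [apply: cvgP; exact: cvg_norm (cg x)|exact: nearW].
Qed.

End bounded_measurable.

(** * Signed integrals of bounded functions *)

Section charge_integral.
Context d (T : measurableType d) (R : realType).
Implicit Types (nu : {charge set T -> \bar R}) (g h : T -> R).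

(** Everything below about signed integrals is read off a difference of two finite
    measures, so the Hahn decomposition chosen in the definition never reappears. *)
Lemma charge_RintegralE nu :
  exists m1 m2 : {finite_measure set T -> \bar R},
    (forall A, measurable A -> nu A = (m1 A - m2 A)%E) /\
    forall h, charge_Rintegral nu h = Rintegral m1 setT h - Rintegral m2 setT h.
Proof.
pose nuPN := projT2 (cid (projT2 (cid (Hahn_decomposition nu)))).
exists (jordan_pos nuPN), (jordan_neg nuPN); split=> // A mA.
by rewrite (jordan_decomp nuPN mA) /cadd/= cscaleN1.
Qed.

Lemma charge_RintegralD nu g h : bounded_measurable g -> bounded_measurable h ->
  charge_Rintegral nu (fun x => g x + h x)
  = charge_Rintegral nu g + charge_Rintegral nu h.
Proof.
move=> bg bh; have [m1 [m2 [_ nuE]]] := charge_RintegralE nu.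
by rewrite !nuE !bounded_RintegralD// opprD addrACA.
Qed.

Lemma charge_RintegralZ nu c g : bounded_measurable g ->
  charge_Rintegral nu (fun x => c * g x) = c * charge_Rintegral nu g.
Proof.
move=> bg; have [m1 [m2 [_ nuE]]] := charge_RintegralE nu.
by rewrite !nuE !bounded_RintegralZ// mulrBr.
Qed.

Lemma charge_RintegralB nu g h : bounded_measurable g -> bounded_measurable h ->
  charge_Rintegral nu (fun x => g x - h x)
  = charge_Rintegral nu g - charge_Rintegral nu h.
Proof.
move=> bg bh; rewrite -[X in _ + X]mulN1r -charge_RintegralZ//.
rewrite -charge_RintegralD//; last exact: bounded_measurableZ.
by congr charge_Rintegral; apply/funext => x; rewrite mulN1r.
Qed.

Lemma charge_Rintegral_sum nu (I : Type) (s : seq I) (g : I -> T -> R) :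
  (forall i, bounded_measurable (g i)) ->
  charge_Rintegral nu (fun x => \sum_(i <- s) g i x)
  = \sum_(i <- s) charge_Rintegral nu (g i).
Proof.
move=> bg; elim: s => [|i s IHs].
  under [in LHS]eq_fun do rewrite big_nil; rewrite big_nil.
  rewrite -[RHS](mul0r (charge_Rintegral nu (fun=> 0))) -charge_RintegralZ.
    by under [in RHS]eq_fun do rewrite mul0r.
  exact: bounded_measurable_cst.
under [in LHS]eq_fun do rewrite big_cons.
by rewrite big_cons charge_RintegralD ?IHs//; exact: bounded_measurable_sum.
Qed.

Lemma charge_Rintegral_indic nu (A : set T) : measurable A ->
  charge_Rintegral nu (\1_A) = fine (nu A).
Proof.
move=> mA; have [m1 [m2 [nuA nuE]]] := charge_RintegralE nu.
by rewrite nuE /Rintegral !integral_indic// setIT nuA// fineB// fin_num_measure.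
Qed.

Lemma charge_Rintegral_cvg nu (g_ : nat -> T -> R) g M :
  (forall n, measurable_fun setT (g_ n)) -> measurable_fun setT g ->
  (forall n x, `|g_ n x| <= M) ->
  (forall x, g_ n x @[n --> \oo] --> g x) ->
  charge_Rintegral nu (g_ n) @[n --> \oo] --> charge_Rintegral nu g.
Proof.
move=> mg_ mg gM cg; have [m1 [m2 [_ nuE]]] := charge_RintegralE nu.
rewrite nuE; under eq_fun do rewrite nuE.
by apply: cvgB; exact: bounded_Rintegral_cvg gM cg.
Qed.

End charge_integral.

(** * The charge of a right-continuous function of bounded variation *)

Section stieltjes_charge.
Context {R : realType}.
Implicit Types (G : R -> R) (nu : {charge set (measurableTypeR R) -> \bar R})
  (m : {finite_measure set (measurableTypeR R) -> \bar R}).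

(** Half-open intervals are stable under intersection and generate the Borel
    sets. *)
Lemma eq_measure_itvoc (m1 m2 : {measure set (measurableTypeR R) -> \bar R}) :
  (forall a b : R, m1 `]a, b]%classic < +oo)%E ->
  (forall a b : R, a <= b -> m1 `]a, b]%classic = m2 `]a, b]%classic) ->
  forall A, measurable A -> m1 A = m2 A.
Proof.
move=> m1oo m12; apply: (@measure_unique _ _ (measurableTypeR R) (@ocitv R)
  (fun n => `](- n%:R), n%:R]%classic)).
- by [].
- exact: ocitvI.
- by move=> i; exact: is_ocitv.
- exact: bigcup_itvT false false.
- move=> A [[a b] _ <-] /=; have [/m12//|ba] := leP a b.
  by rewrite set_itv_ge ?measure0// bnd_simp -leNgt ltW.
- by move=> k; exact: m1oo.
Qed.

(** Moving the subtracted measures to the other side turns this into uniqueness for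
    positive measures, applied to n1 + m2 and n2 + m1 if n1 - n2 represents nu. *)
Lemma stieltjes_charge_unique G nu m1 m2 : is_stieltjes_charge G nu ->
  (forall a b : R, a <= b ->
    (m1 `]a, b]%classic - m2 `]a, b]%classic)%E = (G b - G a)%:E) ->
  forall h, bounded_measurable h ->
    charge_Rintegral nu h = Rintegral m1 setT h - Rintegral m2 setT h.
Proof.
move=> nuG mG h bh; have [n1 [n2 [nuA ->]]] := charge_RintegralE nu.
apply/eqP; rewrite subr_eq addrAC eq_sym subr_eq; apply/eqP.
have mA (m : {finite_measure set (measurableTypeR R) -> \bar R}) (a b : R) :
    m `]a, b]%classic \is a fin_num.
  by apply: fin_num_measure; apply: measurable_itv.
have E (m m' : {finite_measure set (measurableTypeR R) -> \bar R}) :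
    Rintegral m setT h + Rintegral m' setT h
    = Rintegral (measure_add m m') setT h.
  rewrite {3}/Rintegral integral_measure_add//;
    try exact: bounded_measurable_integrable.
  by rewrite fineD//; apply: integrable_fin_num => //;
    exact: bounded_measurable_integrable.
have addE (m m' : {finite_measure set (measurableTypeR R) -> \bar R}) A :
    (measure_add m m' : {measure set (measurableTypeR R) -> \bar R}) A
    = (m A + m' A)%E by exact: measure_addE.
rewrite !E /Rintegral; congr fine; apply: eq_measure_integral => A mA' _.
apply: eq_measure_itvoc => // a b.
  by rewrite addE lte_add_pinfty// ltey_eq mA.
move=> ab; rewrite !addE.
have := nuG a b ab; rewrite -(mG a b ab) nuA; last exact: measurable_itv.
move: (mA m1 a b) (mA m2 a b) (mA n1 a b) (mA n2 a b).
move: (m1 _) (m2 _) (n1 _) (n2 _) => [u||] [v||] [w||] [z||]// _ _ _ _ /=.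
by move=> [] e; congr EFin; lra.
Qed.

(** The bound on the increments passes to the whole line by continuity from below. *)
Lemma stieltjes_finite_measure (f : R -> R) (K : R) :
  nondecreasing f -> right_continuous f -> (forall a b, a <= b -> f b - f a <= K) ->
  exists m : {finite_measure set (measurableTypeR R) -> \bar R},
    (forall a b : R, a <= b -> m `]a, b]%classic = (f b - f a)%:E) /\
    fine (m setT) <= K.
Proof.
move=> fnd frc fK.
pose F : cumulative R R := HB.pack f (isCumulative.Build R _ R f fnd frc).
pose mu := lebesgue_stieltjes_measure F.
have muE a b : a <= b -> mu `]a, b]%classic = (f b - f a)%:E.
  move=> ab; rewrite /mu/= /lebesgue_stieltjes_measure.
  rewrite /measure_extension measurable_mu_extE/= ?wlength_itv_bnd//.
  exact: is_ocitv.
have muK : (mu setT <= K%:E)%E.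
  rewrite -(bigcup_itvT false false).
  pose I n : set R := `](- n%:R), n%:R]%classic.
  have c : mu (I n) @[n --> \oo] --> mu (\bigcup_n I n).
    apply: nondecreasing_cvg_mu; rewrite /I//; first exact: bigcup_measurable.
    by move=> *; apply/subsetPset/subset_itv; rewrite leBSide/= ?lerN2 ler_nat.
  rewrite -(cvg_lim _ c)//; apply: lime_le; first by apply: cvgP c.
  by apply: nearW => n; rewrite muE ?lee_fin ?fK// ge0_cp.
have muoo : (mu setT < +oo)%E by rewrite (le_lt_trans muK)// ltry.
have mE A : mfrestr measurableT muoo A = mu A.
  by rewrite -[in RHS](setIT A).
exists (mfrestr measurableT muoo); split.
  by move=> a b ab; exact: etrans (mE _) (muE _ _ ab).
rewrite [X in fine X](_ : _ = mu setT); last exact: mE.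
by rewrite -lee_fin fineK// ge0_fin_numE// measure_ge0.
Qed.

End stieltjes_charge.

Section stieltjes_jordan.
Context {R : realType}.
Implicit Types (G : R -> R).

Lemma total_variation_le_line G a b : a <= b ->
  (total_variation a b G <= total_variation_line G)%E.
Proof.
have H u v : u < v -> (total_variation u v G <= total_variation_line G)%E.
  by move=> uv; apply: ereal_sup_ubound; exists (u, v).
rewrite le_eqVlt => /predU1P[<-|/H//]; rewrite total_variationxx.
by rewrite (le_trans _ (H 0 1 ltr01))// total_variation_ge0.
Qed.

Lemma total_variation_line_ge0 G : (0 <= total_variation_line G)%E.
Proof.
by apply: le_trans (total_variation_le_line G (lexx 0)); rewrite total_variationxx.
Qed.

(** G = V - (V - G) with V a variation function of G: both terms are nondecreasing
    and right-continuous, with increments at most K and 2 K. *)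
Lemma stieltjes_jordan_decomposition G (K : R) :
  right_continuous G -> (total_variation_line G <= K%:E)%E ->
  exists m1 m2 : {finite_measure set (measurableTypeR R) -> \bar R},
    [/\ forall a b : R, a <= b ->
          (m1 `]a, b]%classic - m2 `]a, b]%classic)%E = (G b - G a)%:E,
        fine (m1 setT) <= K & fine (m2 setT) <= K *+ 2].
Proof.
move=> Grc GK.
have tvle a b : a <= b -> (total_variation a b G <= K%:E)%E.
  by move=> ab; exact: le_trans (total_variation_le_line G ab) GK.
have tvfin a b : a <= b -> total_variation a b G \is a fin_num.
  move=> ab; rewrite ge0_fin_numE ?total_variation_ge0//.
  by rewrite (le_lt_trans (tvle _ _ ab))// ltry.
pose tv a b := fine (total_variation a b G).
have tvD a b c : a <= c -> c <= b -> tv a b = tv a c + tv c b.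
  by move=> ac cb; rewrite /tv (total_variationD _ ac cb) fineD ?tvfin.
have tv_ge a b : a <= b -> `|G b - G a| <= tv a b.
  by move=> ab; rewrite -lee_fin fineK ?tvfin// total_variation_ge.
have tvK a b : a <= b -> tv a b <= K.
  by move=> ab; rewrite -lee_fin fineK ?tvfin// tvle.
have GK2 a b : a <= b -> `|G b - G a| <= K.
  by move=> ab; exact: le_trans (tv_ge _ _ ab) (tvK _ _ ab).
(* The variation from the origin, signed so that its increments are those of
   the variation on either side of it. *)
pose V x := if 0 <= x then tv 0 x else - tv x 0.
have VB x y : x <= y -> V y - V x = tv x y.
  move=> xy; rewrite /V; case: (leP 0 x) => x0; case: (leP 0 y) => y0.
  - by rewrite (tvD 0 y x)// addrC addKr.
  - by have := lt_le_trans y0 (le_trans x0 xy); rewrite ltxx.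
  - by rewrite opprK addrC -tvD// ltW.
  - by rewrite (tvD x 0 y) ?(ltW y0)// opprK addrC addrK.
have Vrc : right_continuous V.
  move=> x; rewrite -[V x]addr0.
  have c : tv x y @[y --> x^'+] --> (0 : R).
    rewrite -[0 : R]/(fine 0) -(total_variationxx x G).
    apply: (@total_variation_right_continuous _ x (x + 1)) => //.
      by rewrite ltrDl.
    by apply/bounded_variationP; rewrite ?lerDl// tvfin// lerDl.
  have : V x + tv x y @[y --> x^'+] --> V x + 0.
    by apply: cvgD => //; exact: cvg_cst.
  apply: cvg_trans; apply: near_eq_cvg; near=> y.
  have xy : x <= y by near: y; exact: nbhs_right_ge.
  by rewrite -(VB _ _ xy) addrC subrK.
have [||a b ab|m1 [m1E m1K]] := @stieltjes_finite_measure R V K.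
- by move=> x y xy; rewrite -subr_ge0 VB// fine_ge0// total_variation_ge0.
- exact: Vrc.
- by rewrite VB// tvK.
have [||a b ab|m2 [m2E m2K]] := @stieltjes_finite_measure R (V \- G) (K *+ 2).
- move=> x y xy /=; have := VB _ _ xy; have := tv_ge _ _ xy.
  by have := ler_norm (G y - G x); lra.
- by move=> x; apply: cvgB; [exact: Vrc|exact: Grc].
- rewrite /=; have := VB _ _ ab; have := tvK _ _ ab; have := GK2 _ _ ab.
  by have := ler_norm (G a - G b); rewrite distrC; lra.
exists m1, m2; split=> // a b ab; rewrite m1E// m2E// -EFinB; congr EFin.
by rewrite /=; lra.
Unshelve. all: by end_near. Qed.

Lemma stieltjes_charge_exists G : class_V G ->
  exists nu : {charge set (measurableTypeR R) -> \bar R},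
    is_stieltjes_charge G nu.
Proof.
move=> [Gfin Grc _].
have [|m1 [m2 [mE _ _]]] := @stieltjes_jordan_decomposition G
  (fine (total_variation_line G)) Grc.
  by rewrite fineK// ge0_fin_numE// total_variation_line_ge0.
pose c (m : {finite_measure set (measurableTypeR R) -> \bar R}) :
  {charge set (measurableTypeR R) -> \bar R} := charge_of_finite_measure m.
exists (cadd (c m1) (cscale (-1) (c m2))) => a b ab.
by rewrite -mE// [LHS]/(_ + _)%E/= cscaleN1.
Qed.

(** The Jordan decomposition by variation functions need not be minimal, so the
    constant is 3 rather than 1; only its uniformity matters. *)
Lemma charge_Rintegral_le_variation G nu (K M : R) (h : R -> R) :
  right_continuous G -> (total_variation_line G <= K%:E)%E ->
  is_stieltjes_charge G nu ->
  bounded_measurable (h : measurableTypeR R -> R) -> (forall x, `|h x| <= M) ->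
  `|charge_Rintegral nu h| <= 3 * K * M.
Proof.
move=> Grc GK nuG bh hM.
have M0 : 0 <= M by exact: le_trans (normr_ge0 _) (hM 0).
have [m1 [m2 [mE m1K m2K]]] := stieltjes_jordan_decomposition Grc GK.
rewrite (stieltjes_charge_unique nuG mE)//.
have := norm_Rintegral_le_mass m1 bh hM; have := norm_Rintegral_le_mass m2 bh hM.
have : M * fine (m1 setT) <= M * K by rewrite ler_wpM2l.
have : M * fine (m2 setT) <= M * (K *+ 2) by rewrite ler_wpM2l.
have -> : 3 * K * M = M * K + M * (K *+ 2) by ring.
move=> m2M m1M Hm2 Hm1; apply: le_trans (ler_normB _ _) _.
by apply: lerD; [exact: le_trans Hm1 m1M|exact: le_trans Hm2 m2M].
Qed.

End stieltjes_jordan.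

(** * Bernstein approximation *)

Section weierstrass.
Context {R : realType}.
Implicit Types (g h : nat -> R) (s : R).

(** [bernstein n g s] is the expectation of g at a binomial variable with
    parameters n and s, computed by conditioning on the first trial. *)
Fixpoint bernstein n g s : R :=
  if n is n'.+1 then
    (1 - s) * bernstein n' g s + s * bernstein n' (fun k => g k.+1) s
  else g 0%N.

Lemma bernsteinD n g h s :
  bernstein n (fun k => g k + h k) s = bernstein n g s + bernstein n h s.
Proof. by elim: n g h => [//|n IHn] g h /=; rewrite !IHn; ring. Qed.

Lemma bernsteinZ n c g s :
  bernstein n (fun k => c * g k) s = c * bernstein n g s.
Proof. by elim: n g => [//|n IHn] g /=; rewrite !IHn; ring. Qed.

Lemma bernstein_cst n c s : bernstein n (fun=> c) s = c.
Proof. by elim: n => [//|n /= ->]; ring. Qed.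

Lemma le_bernstein n g h s : 0 <= s <= 1 -> (forall k, g k <= h k) ->
  bernstein n g s <= bernstein n h s.
Proof.
move=> /andP[s0 s1]; elim: n g h => [|n IHn] g h gh /=; first exact: gh.
have H1 := IHn _ _ gh; have H2 := IHn _ _ (fun k => gh k.+1).
by rewrite lerD// ler_wpM2l// subr_ge0.
Qed.

(** Variance plus squared bias. Keeping c free is what makes the induction go
    through, since the first trial shifts it by 1. *)
Lemma bernstein_sqr n c s : bernstein n (fun k => (k%:R - c) ^+ 2) s
  = n%:R * s * (1 - s) + (n%:R * s - c) ^+ 2.
Proof.
elim: n c => [|n IHn] c /=; first by ring.
rewrite IHn (_ : (fun k : nat => _) = fun k => (k%:R - (c - 1)) ^+ 2).
  by rewrite IHn -natr1; ring.
by apply/funext => k; rewrite -natr1; ring.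
Qed.

(** Chebyshev's argument: away from s the error is at most a multiple of the squared
    distance, whose expectation, the variance, is of order 1 / n. *)
Lemma bernstein_cvg (f : R -> R) (M s : R) : 0 <= s <= 1 ->
  {for s, continuous f} -> (forall x, `|f x| <= M) ->
  bernstein n (fun k => f (k%:R / n%:R)) s @[n --> \oo] --> f s.
Proof.
move=> s01 cf fM; have M0 : 0 <= M by exact: le_trans (normr_ge0 _) (fM 0).
apply/cvgrPdist_le => e e0.
have /cvgrPdist_le /(_ (e / 2)) := cf.
case=> [|d /= d0 fd]; first by rewrite divr_gt0.
pose C := M *+ 2 / d ^+ 2.
have C0 : 0 <= C by rewrite divr_ge0 ?mulrn_wge0// sqr_ge0.
have near_s x : `|f x - f s| <= e / 2 + C * (x - s) ^+ 2.
  have [xs|xs] := ltP `|s - x| d.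
    by rewrite distrC (le_trans (fd x xs))// lerDl mulr_ge0// sqr_ge0.
  rewrite (@le_trans _ _ (M *+ 2))//.
    by rewrite (le_trans (ler_normB _ _))// mulr2n lerD.
  rewrite (@le_trans _ _ (C * (x - s) ^+ 2))//; last by rewrite lerDr divr_ge0// ltW.
  rewrite /C -mulrA ler_peMr ?mulrn_wge0// mulrC ler_pdivlMr ?exprn_gt0// mul1r.
  rewrite -real_normK ?num_real// -[leRHS]real_normK ?num_real//.
  by rewrite ler_pXn2r// ?nnegrE// gtr0_norm// distrC.
near=> n.
have n0 : (0 : R) < n%:R by near: n; exact: nbhs_infty_gtr.
have Bn : bernstein n (fun k => e / 2 + C * (k%:R / n%:R - s) ^+ 2) s <= e.
  rewrite bernsteinD bernstein_cst bernsteinZ.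
  rewrite (_ : (fun k : nat => _)
    = fun k => n%:R ^- 2 * (k%:R - n%:R * s) ^+ 2); last first.
    by apply/funext => k; field; rewrite gt_eqF.
  rewrite bernsteinZ bernstein_sqr subrr expr0n addr0.
  rewrite -lerBrDl (_ : e - e / 2 = e / 2); last by field.
  have -> : C * (n%:R ^- 2 * (n%:R * s * (1 - s))) = C * (s * (1 - s)) / n%:R.
    by field; rewrite gt_eqF.
  rewrite ler_pdivrMr//; apply: (@le_trans _ _ C).
    by rewrite ler_piMr//; nra.
  rewrite -ler_pdivrMl ?divr_gt0//; near: n; exact: nbhs_infty_ger.
set r := bernstein n _ s in Bn; set b := bernstein n _ s.
have ub : b <= f s + r.
  rewrite -(bernstein_cst n (f s) s) -bernsteinD; apply: le_bernstein => // k.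
  by rewrite -lerBlDl (le_trans (ler_norm _)).
have lb : f s <= b + r.
  rewrite -(bernstein_cst n (f s) s) -bernsteinD; apply: le_bernstein => // k.
  by rewrite -lerBlDl (le_trans (ler_norm _))// distrC.
rewrite ler_norml; apply/andP; split; lra.
Unshelve. all: by end_near. Qed.

End weierstrass.

(** * Elementary trigonometric estimates *)

Section trigonometric_bounds.
Context {R : realType}.
Implicit Types (u x y : R).

(** The four Taylor bounds below follow from one another by this principle, each
    being the derivative of the next. *)
Lemma ge0_from_derive (f df : R -> R) u :
  (forall x, is_derive x 1 f (df x)) -> f 0 = 0 ->
  (forall x, 0 <= x -> 0 <= df x) -> 0 <= u -> 0 <= f u.
Proof.
move=> fdf f0 df0 u0; have -> : f u = f u - f 0 by rewrite f0 subr0.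
have cf : {within `[0, u], continuous f}.
  by apply: derivable_within_continuous => x _; have [] := fdf x.
have [c] := MVT_segment u0 (fun x _ => fdf x) cf.
rewrite in_itv/= => /andP[c0 _] ->.
by rewrite mulr_ge0// ?df0// subr0.
Qed.

Lemma sin_le_id u : 0 <= u -> sin u <= u.
Proof.
move=> u0; rewrite -subr_ge0.
apply: (@ge0_from_derive (fun x => x - sin x) (fun x => 1 - cos x)) => //.
by rewrite sin0 subrr.
Qed.

Lemma cos_ge_parabola u : 1 - u ^+ 2 / 2 <= cos u.
Proof.
wlog u0 : u / 0 <= u => [H|].
  have [/H//|/ltW u0] := leP 0 u.
  by rewrite -cosN -[u ^+ 2]sqrrN; apply: H; rewrite oppr_ge0.
rewrite -subr_ge0.
apply: (@ge0_from_derive (fun x => cos x - (1 - x ^+ 2 / 2))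
  (fun x => x - sin x)) => //.
- by move=> x; apply: is_derive_eq; rewrite /GRing.scale/=; field.
- by rewrite cos0 expr0n/= mul0r subr0 subrr.
- by move=> x x0; rewrite subr_ge0 sin_le_id.
Qed.

Lemma sin_ge_cubic u : 0 <= u -> u - u ^+ 3 / 6 <= sin u.
Proof.
move=> u0; rewrite -subr_ge0.
apply: (@ge0_from_derive (fun x => sin x - (x - x ^+ 3 / 6))
  (fun x => cos x - (1 - x ^+ 2 / 2))) => //.
- by move=> x; apply: is_derive_eq; rewrite /GRing.scale/=; field.
- by rewrite sin0 expr0n/= mul0r !subr0.
- by move=> x x0; rewrite subr_ge0 cos_ge_parabola.
Qed.

Lemma cos_le_quartic u : cos u <= 1 - u ^+ 2 / 2 + u ^+ 4 / 24.
Proof.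
wlog u0 : u / 0 <= u => [H|].
  have [/H//|/ltW u0] := leP 0 u.
  rewrite -cosN -[u ^+ 2]sqrrN -[u ^+ 4]/(u ^+ (2 * 2)) exprM -[u ^+ 2]sqrrN -exprM.
  by apply: H; rewrite oppr_ge0.
rewrite -subr_ge0.
apply: (@ge0_from_derive (fun x => 1 - x ^+ 2 / 2 + x ^+ 4 / 24 - cos x)
  (fun x => sin x - (x - x ^+ 3 / 6))) => //.
- by move=> x; apply: is_derive_eq; rewrite /GRing.scale/=; field.
- by rewrite cos0 !expr0n/= !mul0r subr0 addr0 subrr.
- by move=> x x0; rewrite subr_ge0 sin_ge_cubic.
Qed.

Lemma norm_sin_le u : `|sin u| <= `|u|.
Proof.
wlog u0 : u / 0 <= u => [H|].
  have [/H//|/ltW u0] := leP 0 u.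
  by rewrite -normrN -sinN -[leRHS]normrN; apply: H; rewrite oppr_ge0.
rewrite (ger0_norm u0) ler_norml sin_le_id// andbT.
have [u1|u1] := leP u 1; last by rewrite (le_trans _ (sin_geN1 u))// lerN2 ltW.
apply: le_trans (sin_ge_cubic u0); nra.
Qed.

Lemma norm_sinB_id_le u : `|sin u - u| <= `|u| ^+ 3 / 6.
Proof.
wlog u0 : u / 0 <= u => [H|].
  have [/H//|/ltW u0] := leP 0 u.
  by have := H (- u); rewrite oppr_ge0 sinN -opprD !normrN; apply.
rewrite (ger0_norm u0) ler_norml.
have := sin_le_id u0; have := sin_ge_cubic u0.
have := exprn_ge0 3 u0; move: (u ^+ 3) => v *; apply/andP; split; lra.
Qed.

Lemma norm_cosB1_le u : `|cos u - 1| <= u ^+ 2 / 2.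
Proof.
rewrite ler_norml; have := cos_ge_parabola u; have := cos_le1 u.
by have := sqr_ge0 u; move: (u ^+ 2) => v *; apply/andP; split; lra.
Qed.

Lemma norm_cos_parabola_le u : `|cos u - 1 + u ^+ 2 / 2| <= u ^+ 4 / 24.
Proof.
rewrite ger0_norm; last by have := cos_ge_parabola u; lra.
by have := cos_le_quartic u; lra.
Qed.

(** The minimum makes the right-hand side bounded in x and y, so that it can later be
    integrated against any law. *)
Lemma norm_cosB_le x y : `|cos x - cos y| <= Num.min 2 `|x - y|.
Proof.
pose a := (x + y) / 2; pose b := (x - y) / 2.
have -> : x - y = b *+ 2 by rewrite /b; field.
have -> : x = a + b by rewrite /a/b; field.
have -> : y = a - b by rewrite /a/b; field.
rewrite cosD cosB.
have -> : cos a * cos b - sin a * sin b - (cos a * cos b + sin a * sin b)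
  = - (sin a * sin b *+ 2) by ring.
rewrite normrN !normrMn normrM le_min; apply/andP; split.
  by rewrite -[2]/(1 *+ 2) lerMn2r/= mulr_ile1// ?sin_max.
rewrite lerMn2r/=; apply: le_trans (norm_sin_le b).
by rewrite ler_piMl// sin_max.
Qed.

Lemma norm_sinB_le x y : `|sin x - sin y| <= Num.min 2 `|x - y|.
Proof.
rewrite -!cosBpihalf; apply: le_trans (norm_cosB_le _ _) _.
by rewrite (_ : _ - _ - _ = x - y)//; ring.
Qed.

(** sin u = u + O(u^3), so the error is of order 1 / n^2. *)
Lemma cvg_natM_sin y : n.+1%:R * sin (y / n.+1%:R) @[n --> \oo] --> y.
Proof.
apply/cvgrPdist_le => e e0; near=> n.
have n0 : (0 : R) < n.+1%:R by [].
have -> : y - n.+1%:R * sin (y / n.+1%:R)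
    = - (n.+1%:R * (sin (y / n.+1%:R) - y / n.+1%:R)).
  by rewrite mulrBr mulrCA divff ?gt_eqF// mulr1 opprB.
rewrite normrN normrM gtr0_norm// -ler_pdivlMl//.
apply: le_trans (norm_sinB_id_le _) _; rewrite normrM normfV (gtr0_norm n0).
rewrite exprMn exprVn -(ler_pM2r (exprn_gt0 3 n0)).
rewrite (_ : _ / 6 * _ = `|y| ^+ 3 / 6); last by field; rewrite gt_eqF.
rewrite (_ : _^-1 * e * _ = n.+1%:R ^+ 2 * e); last by field; rewrite gt_eqF.
rewrite -ler_pdivrMr//; apply: (@le_trans _ _ n.+1%:R).
  by apply: (@le_trans _ _ n%:R); [near: n; exact: nbhs_infty_ger|rewrite ler_nat].
by rewrite ler_eXnr// ler1n.
Unshelve. all: by end_near. Qed.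

End trigonometric_bounds.

(** * Uniqueness of characteristic functions *)

Section continuous_functions.
Context {R : realType}.
Implicit Types (f g : R -> R).
Local Notation T := (measurableTypeR R).

Lemma continuous_compR f g :
  continuous f -> continuous g -> continuous (fun x => g (f x)).
Proof. by move=> cf cg x; exact: continuous_comp (cf x) (cg (f x)). Qed.

Lemma continuousM_fun f g :
  continuous f -> continuous g -> continuous (fun x => f x * g x).
Proof. by move=> cf cg x; apply: cvgM; [exact: cf|exact: cg]. Qed.

Lemma continuous_mulr (a : R) : continuous (fun x : R => a * x).
Proof. by move=> x; apply: cvgM; [exact: cvg_cst|exact: cvg_id]. Qed.

Lemma continuous_affine (a c : R) : continuous (fun x : R => a * x + c).
Proof.
by move=> x; apply: cvgD; [exact: continuous_mulr|exact: cvg_cst].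
Qed.

Lemma continuous_cosZ (a : R) : continuous (fun x : R => cos (a * x)).
Proof. exact: continuous_compR (@continuous_mulr a) (@continuous_cos R). Qed.

Lemma continuous_sinZ (a : R) : continuous (fun x : R => sin (a * x)).
Proof. exact: continuous_compR (@continuous_mulr a) (@continuous_sin R). Qed.

Lemma continuous_bounded_measurable f M : continuous f ->
  (forall x, `|f x| <= M) -> bounded_measurable (f : T -> R).
Proof.
by move=> cf fM; split; [exact: continuous_measurable_fun|exists M].
Qed.

Lemma bounded_measurable_cos (a c : R) :
  bounded_measurable ((fun x : R => cos (a * x + c)) : T -> R).
Proof.
apply: (@continuous_bounded_measurable _ 1) => [|x]; last exact: cos_max.
exact: continuous_compR (@continuous_affine a c) (@continuous_cos R).
Qed.

Lemma bounded_measurable_cosZ (a : R) :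
  bounded_measurable ((fun x : R => cos (a * x)) : T -> R).
Proof.
apply: (@continuous_bounded_measurable _ 1) => [|x]; last exact: cos_max.
exact: continuous_cosZ.
Qed.

Lemma bounded_measurable_sin (a : R) :
  bounded_measurable ((fun x : R => sin (a * x)) : T -> R).
Proof.
apply: (@continuous_bounded_measurable _ 1) => [|x]; last exact: sin_max.
exact: continuous_sinZ.
Qed.

End continuous_functions.

Section characteristic_uniqueness.
Context {R : realType}.
Implicit Types (g h : R -> R).
Local Notation T := (measurableTypeR R).

Context (m1 m2 : {finite_measure set T -> \bar R}).

(** Closing the class under multiplication by sines is what allows polynomials
    in a sine to be reached; hence the trigonometric factor in its definition. *)
Definition trig_indistinguishable g :=
  bounded_measurable (g : T -> R) /\ forall t c : R,
    Rintegral m1 setT (fun x : R => g x * cos (t * x + c))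
    = Rintegral m2 setT (fun x : R => g x * cos (t * x + c)).

Lemma trig_indistinguishableD g h :
  trig_indistinguishable g -> trig_indistinguishable h ->
  trig_indistinguishable (fun x => g x + h x).
Proof.
move=> [bg gE] [bh hE]; split; first exact: bounded_measurableD.
move=> t c; under eq_fun do rewrite mulrDl.
rewrite !bounded_RintegralD ?gE ?hE//;
  by apply: bounded_measurableM => //; exact: bounded_measurable_cos.
Qed.

Lemma trig_indistinguishableZ a g :
  trig_indistinguishable g -> trig_indistinguishable (fun x => a * g x).
Proof.
move=> [bg gE]; split; first exact: bounded_measurableZ.
move=> t c; under eq_fun do rewrite -mulrA.
rewrite !bounded_RintegralZ ?gE//;
  by apply: bounded_measurableM => //; exact: bounded_measurable_cos.
Qed.

Lemma trig_indistinguishable_sinM a g :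
  trig_indistinguishable g -> trig_indistinguishable (fun x => sin (a * x) * g x).
Proof.
move=> [bg gE]; split.
  by apply: bounded_measurableM => //; exact: bounded_measurable_sin.
move=> t c; pose C s := fun x : R => g x * cos (s * x + (c - pi / 2)).
have bC s : bounded_measurable (C s : T -> R).
  by apply: bounded_measurableM => //; exact: bounded_measurable_cos.
have -> : (fun x => sin (a * x) * g x * cos (t * x + c))
    = (fun x => 2^-1 * (C (t + a) x - C (t - a) x)).
  apply/funext => x; rewrite /C !addrA !cosBpihalf !mulrDl mulNr.
  rewrite (addrAC (t * x) (a * x)) (addrAC (t * x) (- (a * x))) sinD sinB.
  by field.
by rewrite !bounded_RintegralZ ?bounded_RintegralB ?gE//; exact: bounded_measurableB.
Qed.

Lemma trig_indistinguishable_bernstein a n (g : nat -> R) :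
  (forall t c : R, Rintegral m1 setT (fun x : R => cos (t * x + c))
    = Rintegral m2 setT (fun x : R => cos (t * x + c))) ->
  trig_indistinguishable (fun x => bernstein n g ((1 + sin (a * x)) / 2)).
Proof.
move=> cosE; elim: n g => [|n IHn] g /=.
  rewrite -[g 0%N]mulr1; apply: trig_indistinguishableZ.
  split; first exact: bounded_measurable_cst.
  move=> t c; under eq_fun do rewrite mul1r.
by [].
set B0 := bernstein n g; set B1 := bernstein n _.
pose s (x : R) := (1 + sin (a * x)) / 2.
have -> : (fun x => (1 - s x) * B0 (s x) + s x * B1 (s x))
    = (fun x => 2^-1 * (B0 ((1 + sin (a * x)) / 2)
    + B1 ((1 + sin (a * x)) / 2) + (sin (a * x) * B1 ((1 + sin (a * x)) / 2)
    + -1 * (sin (a * x) * B0 ((1 + sin (a * x)) / 2))))).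
  by apply/funext => x; rewrite -/(s x); move: (B0 _) (B1 _) => u v; rewrite /s; field.
apply: trig_indistinguishableZ; apply: trig_indistinguishableD.
  by apply: trig_indistinguishableD; exact: IHn.
apply: trig_indistinguishableD; last apply: trig_indistinguishableZ.
  by apply: trig_indistinguishable_sinM; exact: IHn.
by apply: trig_indistinguishable_sinM; exact: IHn.
Qed.

(** By Bernstein's form of the Weierstrass theorem the integral of any continuous
    function of sin (x / N) is determined, in particular that of h (N sin (x / N)),
    which tends boundedly to h as N grows. *)
Lemma eq_Rintegral_of_cos h M :
  (forall t c : R, Rintegral m1 setT (fun x : R => cos (t * x + c))
    = Rintegral m2 setT (fun x : R => cos (t * x + c))) ->
  continuous h -> (forall x, `|h x| <= M) ->
  Rintegral m1 setT h = Rintegral m2 setT h.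
Proof.
move=> cosE ch hM.
have mh : measurable_fun setT (h : T -> R) by exact: continuous_measurable_fun.
pose hN (N : nat) (x : R) := h (N.+1%:R * sin (N.+1%:R^-1 * x)).
have chN N : continuous (hN N).
  apply: (@continuous_compR R (fun x => N.+1%:R * sin (N.+1%:R^-1 * x)) h) => // x.
  by apply: cvgM; [exact: cvg_cst|exact: continuous_sinZ].
have mhN N : measurable_fun setT (hN N : T -> R) by exact: continuous_measurable_fun.
have hNE N : Rintegral m1 setT (hN N) = Rintegral m2 setT (hN N).
  pose f y := h (N.+1%:R * (2 * y - 1)).
  have cf : continuous f.
    apply: (@continuous_compR R (fun y => N.+1%:R * (2 * y - 1)) h) => // y.
    by apply: cvgM; [exact: cvg_cst|exact: continuous_affine].
  pose s (x : R) := (1 + sin (N.+1%:R^-1 * x)) / 2.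
  have s01 x : 0 <= s x <= 1.
    by rewrite /s; have := sin_geN1 (N.+1%:R^-1 * x);
      have := sin_le1 (N.+1%:R^-1 * x); move=> *; apply/andP; split; lra.
  pose B n (x : R) := bernstein n (fun k => f (k%:R / n%:R)) (s x).
  have BE n : trig_indistinguishable (B n).
    exact: trig_indistinguishable_bernstein.
  have BM n x : `|B n x| <= M.
    rewrite ler_norml -(bernstein_cst n M (s x)) -(mulN1r (bernstein _ _ _)).
    rewrite -bernsteinZ; apply/andP; split; apply: le_bernstein => // k.
      pose y := N.+1%:R * (2 * (k%:R / n%:R) - 1) : R.
      by rewrite mulN1r lerNl (le_trans _ (hM y))// -normrN ler_norm.
    by rewrite (le_trans (ler_norm _))// hM.
  have Bcvg x : B n x @[n --> \oo] --> hN N x.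
    rewrite [hN N x](_ : _ = f (s x)); last first.
    by rewrite /f /hN /s; congr (h (_ * _)); field.
    apply: (@bernstein_cvg _ f M); [exact: s01|exact: cf|by move=> y; exact: hM].
  have H (m : {finite_measure set T -> \bar R}) :
      Rintegral m setT (B n) @[n --> \oo] --> Rintegral m setT (hN N).
    have mB n : measurable_fun setT (B n : T -> R) by have [[]] := BE n.
    exact: bounded_Rintegral_cvg mB (mhN N) BM Bcvg.
  have HB n : Rintegral m1 setT (B n) = Rintegral m2 setT (B n).
    have [_ /(_ 0 0)] := BE n.
    under eq_fun do rewrite mul0r addr0 cos0 mulr1.
by [].
  have := H m1; under eq_fun do rewrite HB; move=> c1.
  exact: (cvg_unique _ c1 (H m2)).
have hNM N x : `|hN N x| <= M by exact: hM.
have hNcvg x : hN N x @[N --> \oo] --> h x.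
  apply: continuous_cvg; first exact: ch.
  by under eq_fun do rewrite [_^-1 * x]mulrC; exact: cvg_natM_sin.
have c2 := @bounded_Rintegral_cvg _ _ _ m2 _ _ _ mhN mh hNM hNcvg.
have := @bounded_Rintegral_cvg _ _ _ m1 _ _ _ mhN mh hNM hNcvg.
under eq_fun do rewrite hNE; move=> c1.
exact: (cvg_unique _ c1 c2).
Qed.

End characteristic_uniqueness.

(** * Basic convergence and functions vanishing at infinity *)

Section vanishing_at_infinity.
Context {R : realType}.
Implicit Types (phi : R -> R).

Definition vanishes_at_infinity phi :=
  forall e, 0 < e -> exists A, forall x, A <= `|x| -> `|phi x| <= e.

Lemma vanishing_uniformly_continuous phi e :
  continuous phi -> vanishes_at_infinity phi -> 0 < e ->
  exists2 d, 0 < d & forall x y, `|x - y| < d -> `|phi x - phi y| <= e.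
Proof.
move=> cphi vphi e0; have e20 : 0 < e / 2 by rewrite divr_gt0.
have [A phiA] := vphi _ e20.
have := @segment_compact R (- (`|A| + 1)) (`|A| + 1).
move/compact_near_coveringP => /(_ R (0 : R)^'+
  (fun d x => forall y, `|x - y| < d -> `|phi x - phi y| <= e) _).
case=> [x _|d /= d0 dP].
  have /cvgrPdist_le /(_ _ e20) [r /= r0 rP] := cphi x.
  exists (ball x (r / 2), [set d | d < r / 2]); first split => /=.
  - by apply: nbhsx_ballx; rewrite divr_gt0.
  - exact: nbhs_right_lt (divr_gt0 _ _).
  - move=> [x' d] /= [xx' dr] y x'y.
    have h1 : `|phi x - phi x'| <= e / 2.
      apply: rP; apply: (lt_le_trans xx').
      by rewrite ler_pdivrMr// ler_peMr ?ltW// ltr1n.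
    have h2 : `|phi x - phi y| <= e / 2.
      apply: rP; rewrite /= (splitr r) -(subrKA x').
      by rewrite (le_lt_trans (ler_normD _ _))// ltrD// (lt_trans x'y).
    rewrite [e]splitr -(subrKA (phi x)) (le_trans (ler_normD _ _))// lerD//.
    by rewrite distrC.
pose d1 := Num.min 1 (d / 2).
have d10 : 0 < d1 by rewrite lt_min ltr01 divr_gt0.
exists d1 => // x y; rewrite lt_min => /andP[xy1 xyd].
have [xA|xA] := leP `|x| (`|A| + 1).
  apply: (dP (d / 2)) => //=.
  - by rewrite sub0r normrN gtr0_norm ?divr_gt0// ltr_pdivrMr// ltr_pMr// ltr1n.
  - by rewrite divr_gt0.
  - by rewrite in_itv/= -ler_norml.
rewrite [e]splitr (le_trans (ler_normB _ _))// lerD// phiA//.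
  by rewrite (le_trans (ler_norm A))// ltW// (lt_trans _ xA)// ltrDl.
rewrite (le_trans (ler_norm A))// ltW//.
have := ler_distD 0 x y; rewrite subr0 sub0r normrN => _.
have : `|x| <= `|x - y| + `|y| by rewrite -{1}(subrK y x) ler_normD.
lra.
Qed.

(** The offsets to be avoided form a countable, hence null, set. *)
Lemma avoid_countable (D : set R) (g : nat -> R) : countable D ->
  exists2 u : R, 0 <= u < 1 & forall i, ~ D (g i + u).
Proof.
move=> cD; pose B := \bigcup_i [set (y - g i : R) | y in D].
have cB : countable B.
  apply: bigcup_countable => // i _; apply: card_le_trans cD.
  exact: card_image_le.
apply: contrapT => H; pose I : set R := `[0, 1[%classic.
have : (lebesgue_measure I <= lebesgue_measure B)%E.
  apply: le_measure; rewrite ?inE; [exact: measurable_itv|exact: countable_measurable|].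
  move=> u; rewrite /I/= in_itv/= => u01.
  apply: contrapT => uB; apply: H; exists u => // i Di; apply: uB.
  by exists i => //; exists (g i + u) => //; rewrite addrC addKr.
have -> : lebesgue_measure I = 1%:E.
  by have /= -> := @lebesgue_measure_itv R `[0, 1[; rewrite lte_fin ltr01 oppr0 adde0.
by rewrite countable_lebesgue_measure0// lee_fin leNgt ltr01.
Qed.

Definition itvoc_step (m : nat) (g c : nat -> R) (x : R) : R :=
  \sum_(0 <= i < m) c i * \1_(`]g i, g i.+1]%classic) x.

Lemma itvoc_stepP m g c x : {homo g : i j / (i <= j)%N >-> i <= j} ->
  (g 0%N < x <= g m -> exists2 i, g i < x <= g i.+1 & itvoc_step m g c x = c i)
  /\ (~~ (g 0%N < x <= g m) -> itvoc_step m g c x = 0).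
Proof.
move=> gnd; elim: m => [|m [IH1 IH2]].
  rewrite /itvoc_step big_geq//; split=> // /andP[a b].
  by have := lt_le_trans a b; rewrite ltxx.
have E : itvoc_step m.+1 g c x
    = itvoc_step m g c x + c m * \1_(`]g m, g m.+1]%classic) x.
  by rewrite /itvoc_step big_nat_recr.
have I : \1_(`]g m, g m.+1]%classic) x = ((g m < x <= g m.+1)%R : bool)%:R :> R.
  by rewrite indicE mem_setE in_itv.
rewrite E I; have [xm|xm] := leP x (g m).
  rewrite mulr0 addr0 (le_trans xm (gnd _ _ (leqnSn m))) andbT.
  rewrite xm andbT in IH1 IH2.
  by split.
have -> : itvoc_step m g c x = 0 by apply: IH2; rewrite negb_and -ltNge xm orbT.
have -> /= : g 0%N < x by rewrite (le_lt_trans _ xm)// gnd.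
split=> [xm1|/negbTE ->]; last by rewrite mulr0 addr0.
by exists m; rewrite ?xm// xm1 mulr1 add0r.
Qed.

End vanishing_at_infinity.

Section basic_convergence.
Context {R : realType}.
Implicit Types (phi G : R -> R).
Local Notation T := (measurableTypeR R).

Lemma bounded_measurable_itvoc_step m (g c : nat -> R) :
  bounded_measurable (itvoc_step m g c : T -> R).
Proof.
apply: bounded_measurable_sum => i; apply: bounded_measurableZ.
by apply: bounded_measurable_indic; exact: measurable_itv.
Qed.

Lemma charge_Rintegral_itvoc_step G nu m (g c : nat -> R) :
  is_stieltjes_charge G nu -> {homo g : i j / (i <= j)%N >-> i <= j} ->
  charge_Rintegral nu (itvoc_step m g c)
  = \sum_(0 <= i < m) c i * (G (g i.+1) - G (g i)).
Proof.
move=> nuG gnd; rewrite /itvoc_step charge_Rintegral_sum.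
  apply: eq_bigr => i _; rewrite charge_RintegralZ ?charge_Rintegral_indic.
  - by rewrite nuG// gnd.
  - exact: measurable_itv.
  - by apply: bounded_measurable_indic; exact: measurable_itv.
move=> i; apply: bounded_measurableZ.
by apply: bounded_measurable_indic; exact: measurable_itv.
Qed.

(** A function vanishing at infinity is uniformly close to a step function with
    finitely many steps whose breakpoints avoid the exceptional set. The integrals
    of the step function converge by hypothesis, and the uniform bound on the
    variations controls the error for all charges at once. *)
Lemma basic_cvg_charge_Rintegral (Gn : nat -> R -> R) G nun nu
    (K M : R) (D : set R) phi :
  (forall n, right_continuous (Gn n)) -> right_continuous G ->
  (forall n, (total_variation_line (Gn n) <= K%:E)%E) ->
  (total_variation_line G <= K%:E)%E ->
  (forall n, is_stieltjes_charge (Gn n) (nun n)) -> is_stieltjes_charge G nu ->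
  countable D ->
  (forall x1 x2, ~ D x1 -> ~ D x2 ->
    Gn n x2 - Gn n x1 @[n --> \oo] --> G x2 - G x1) ->
  continuous phi -> (forall x, `|phi x| <= M) -> vanishes_at_infinity phi ->
  charge_Rintegral (nun n) phi @[n --> \oo] --> charge_Rintegral nu phi.
Proof.
move=> Gnrc Grc GnK GK nunG nuG cD Gcvg cphi phiM vphi.
have bphi := continuous_bounded_measurable cphi phiM.
have K0 : 0 <= K by rewrite -lee_fin (le_trans _ GK)// total_variation_line_ge0.
apply/cvgrPdist_le => e e0.
pose e1 := e / (6 * K + 1).
have e10 : 0 < e1 by rewrite divr_gt0//; lra.
have [A phiA] := vphi _ e10.
have [d d0 phid] := vanishing_uniformly_continuous cphi vphi e10.
pose B := `|A| + 1.
pose g0 i := - B + d / 2 * i%:R.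
have [u /andP[u0 u1] Du] := avoid_countable g0 cD.
pose g i := g0 i + u.
have gnd : {homo g : i j / (i <= j)%N >-> i <= j}.
  by move=> i j ij; rewrite lerD2r lerD2l ler_wpM2l ?ler_nat// divr_ge0// ltW.
have d20 : 0 < d / 2 by rewrite divr_gt0.
pose m := (Num.truncn (2 * B / (d / 2))).+1.
have gm : B <= g m.
  have : 2 * B / (d / 2) < m%:R by rewrite truncnS_gt.
  rewrite ltr_pdivrMr// [m%:R * _]mulrC /g /g0.
  by move: (d / 2 * _) => w; lra.
pose s := itvoc_step m g (phi \o g).
have bs : bounded_measurable (s : T -> R) by exact: bounded_measurable_itvoc_step.
have phis x : `|phi x - s x| <= e1.
  have [s1 s2] := itvoc_stepP m (phi \o g) x gnd.
  have [xg|xg] := boolP (g 0%N < x <= g m).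
    have [i /andP[ix xi] E] := s1 xg.
    rewrite /s E; apply: phid; rewrite ger0_norm ?subr_ge0 ?ltW//.
    rewrite ltrBlDl (le_lt_trans xi)// /g /g0 -[i.+1%:R]natr1 mulrDr mulr1.
    by move: (d / 2 * _) => w; lra.
  rewrite /s s2// subr0; apply: phiA; rewrite (le_trans (ler_norm A))//.
  move: xg; rewrite negb_and -leNgt -ltNge => /orP[xg|xg].
    rewrite -[leRHS]normrN (le_trans _ (ler_norm _))// lerNr (le_trans xg)//.
    by rewrite /g /g0 /B mulr0; lra.
  rewrite (le_trans _ (ler_norm _))// ltW// (le_lt_trans _ xg)//.
  by rewrite (le_trans _ gm)// lerDl.
have approx G' nu' : right_continuous G' -> (total_variation_line G' <= K%:E)%E ->
    is_stieltjes_charge G' nu' ->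
    `|charge_Rintegral nu' phi - charge_Rintegral nu' s| <= 3 * K * e1.
  move=> G'rc G'K nu'G; rewrite -charge_RintegralB//.
  apply: (charge_Rintegral_le_variation G'rc G'K nu'G) => //.
  exact: bounded_measurableB.
have scvg : charge_Rintegral (nun n) s @[n --> \oo] --> charge_Rintegral nu s.
  rewrite (charge_Rintegral_itvoc_step m (phi \o g) nuG gnd).
  under eq_fun do rewrite (charge_Rintegral_itvoc_step m (phi \o g) (nunG _) gnd).
  apply: cvg_big => [|i _]; first exact: add_continuous.
  apply: cvgM; first exact: cvg_cst.
  by apply: Gcvg; exact: Du.
move/cvgrPdist_le : scvg => /(_ _ e10); apply: filterS => n sn.
have h1 := approx _ _ (Gnrc n) (GnK n) (nunG n).
have h2 := approx _ _ Grc GK nuG.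
have -> : e = 3 * K * e1 + e1 + 3 * K * e1.
  by rewrite /e1; field; rewrite gt_eqF//; lra.
have -> : charge_Rintegral nu phi - charge_Rintegral (nun n) phi
    = (charge_Rintegral nu phi - charge_Rintegral nu s)
      + (charge_Rintegral nu s - charge_Rintegral (nun n) s)
      - (charge_Rintegral (nun n) phi - charge_Rintegral (nun n) s) by ring.
rewrite (le_trans (ler_normB _ _))// lerD//.
by rewrite (le_trans (ler_normD _ _))// lerD.
Qed.

End basic_convergence.

(** * Smoothing by uniform averages of cosines *)

Section sinc.
Context {R : realType}.
Implicit Types (x y a d : R).

Lemma continuous_patch0 (f : R -> R) (c C : R) :
  (forall x, x != 0 -> {for x, continuous f}) ->
  (forall x, x != 0 -> `|x| <= 1 -> `|f x - c| <= C * `|x|) ->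
  continuous (fun x => if x == 0 then c else f x).
Proof.
move=> cf fc x; have [->|x0] := eqVneq x 0; last first.
  have H : f y @[y --> x] --> (if x == 0 then c else f x).
    by rewrite (negbTE x0); exact: cf.
  have xn0 : \forall y \near x, y != 0.
    exact: (@cvgr_neq0 _ _ _ _ _ (fun y : R => y) x cvg_id x0).
  apply: cvg_trans H; apply: near_eq_cvg; near=> y.
  by have /negbTE -> : y != 0 by near: y.
have C1 : 0 < `|C| + 1 by rewrite ltr_wpDl.
have near0 r : 0 < r -> \forall y \near (0 : R), `|y| <= r.
  by move=> r0; exists r => //= y; rewrite /ball/= sub0r normrN => /ltW.
apply/cvgrPdist_le => e e0; rewrite eqxx.
have near_e := near0 _ (mulr_gt0 (etrans (invr_gt0 _) C1) e0).
near=> y.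
have [_|y0] := eqVneq y 0; first by rewrite subrr normr0 ltW.
have Cy : `|C| * `|y| <= e.
  rewrite (@le_trans _ _ ((`|C| + 1) * `|y|))// ?ler_wpM2r ?lerDl//.
  rewrite -ler_pdivlMl//.
  by near: y.
have y1 : `|y| <= 1 by near: y; exact: near0.
rewrite distrC (le_trans (fc y y0 y1))//.
by rewrite (le_trans _ Cy)// ler_wpM2r// ler_norm.
Unshelve. all: by end_near. Qed.

Definition sinc y : R := if y == 0 then 1 else sin y / y.

Lemma continuous_sinc : continuous sinc.
Proof.
apply: (@continuous_patch0 (fun y => sin y / y) 1 (1 / 6)) => [x x0|x x0 x1].
  by apply: cvgM; [exact: continuous_sin|apply: cvgV => //; exact: cvg_id].
rewrite (_ : sin x / x - 1 = (sin x - x) / x); last by field.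
rewrite normrM normfV ler_pdivrMr ?normr_gt0//.
apply: le_trans (norm_sinB_id_le x) _.
rewrite (_ : `|x| ^+ 3 / 6 = 1 / 6 * `|x| * `|x| * `|x|); last by field.
by rewrite ler_piMr// !mulr_ge0.
Qed.

Lemma norm_sinc_le1 y : `|sinc y| <= 1.
Proof.
rewrite /sinc; case: eqVneq => [_|y0]; first by rewrite normr1.
by rewrite normrM normfV ler_pdivrMr ?normr_gt0// mul1r norm_sin_le.
Qed.

Lemma norm_sinc_le_inv y : y != 0 -> `|sinc y| <= `|y|^-1.
Proof.
move=> y0; rewrite /sinc (negbTE y0) normrM normfV ler_piMl ?invr_ge0//.
exact: sin_max.
Qed.

Lemma cvg_sinc1 x : sinc (n.+1%:R^-1 * x) @[n --> \oo] --> (1 : R).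
Proof.
have e : sinc (0 * x) = 1 by rewrite mul0r /sinc eqxx.
suff : sinc (n.+1%:R^-1 * x) @[n --> \oo] --> sinc (0 * x) by rewrite e.
apply: continuous_cvg; first exact: continuous_sinc.
by apply: cvgM; [exact: cvg_harmonic|exact: cvg_cst].
Qed.

Lemma dirichlet_sum n y :
  2 * sin y * (\sum_(0 <= j < n) cos ((j.*2.+1)%:R * y)) = sin (n.*2%:R * y).
Proof.
elim: n => [|n IHn]; first by rewrite big_geq// mul0r sin0 mulr0.
rewrite big_nat_recr//= mulrDr IHn.
have -> : n.*2%:R * y = (n.*2.+1)%:R * y - y by rewrite -natr1; ring.
have -> : n.+1.*2%:R * y = (n.*2.+1)%:R * y + y by rewrite doubleS -natr1; ring.
by rewrite sinB sinD; ring.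
Qed.

(** Midpoint sums for the mean of cos (a x) over a in [0, d]. *)
Definition mean_cos d n x : R :=
  n.+1%:R^-1 * \sum_(0 <= j < n.+1) cos ((j.*2.+1)%:R * (d / n.+1.*2%:R) * x).

(** In the closed form of the Dirichlet sum the factor 2 N sin (d x / 2 N) tends to
    d x; dividing by it only in the limit avoids its zeros. *)
Lemma cvg_mean_cos d x : mean_cos d n x @[n --> \oo] --> sinc (d * x).
Proof.
rewrite /sinc; have [dx0|dx0] := eqVneq (d * x) 0.
  rewrite [X in X @ _ --> _](_ : _ = fun=> 1); first exact: cvg_cst.
  apply/funext => n; rewrite /mean_cos.
  rewrite (eq_bigr (fun=> 1)) => [|j _].
    by rewrite big_const_nat subn0 iter_addr_0 mulVf// pnatr_eq0.
  by rewrite -mulrA mulrAC dx0 mul0r mulr0 cos0.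
pose w n := n.+1.*2%:R * sin (d * x / n.+1.*2%:R).
have wE n : w n * mean_cos d n x = sin (d * x).
  have := dirichlet_sum n.+1 (d * x / n.+1.*2%:R).
  rewrite mulrCA divff ?mulr1 ?pnatr_eq0// => <-.
  rewrite /w /mean_cos.
  under [in LHS]eq_bigr do rewrite -mulrA [d / _ * _]mulrAC.
  set S := \sum_(0 <= j < _) _; rewrite -muln2 natrM.
  have : n.+1%:R != 0 :> R by rewrite pnatr_eq0.
  by move: (n.+1%:R) S (sin _) => N S t N0; field.
have cw : w n @[n --> \oo] --> d * x.
  have dbl : n.*2.+1 @[n --> \oo] --> \oo.
    move=> A [N _ NA]; exists N => // n /= Nn; apply: NA => /=.
    by rewrite (leq_trans Nn)// -addnn -addnS leq_addr.
  exact: (cvg_comp _ _ dbl (@cvg_natM_sin R (d * x))).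
have : sin (d * x) / w n @[n --> \oo] --> sin (d * x) / (d * x).
  by apply: cvgM; [exact: cvg_cst|exact: cvgV].
apply: cvg_trans; apply: near_eq_cvg; near=> n.
have w0 : w n != 0 by near: n; exact: (cvgr_neq0 _ cw dx0).
by rewrite -(wE n) mulrAC divff// mul1r.
Unshelve. all: by end_near. Qed.

Lemma norm_mean_cos_le1 d n x : `|mean_cos d n x| <= 1.
Proof.
rewrite /mean_cos normrM gtr0_norm ?invr_gt0// ler_pdivrMl// mulr1.
rewrite (le_trans (ler_norm_sum _ _ _))//.
rewrite (@le_trans _ _ (\sum_(0 <= j < n.+1) 1))//.
  by apply: ler_sum => j _; exact: cos_max.
by rewrite big_const_nat subn0 iter_addr_0.
Qed.

End sinc.

Section smoothing.
Context {R : realType}.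
Local Notation T := (measurableTypeR R).
Implicit Types (k : R -> R) (nu : {charge set T -> \bar R}).

Lemma continuous_sincZ (d : R) : continuous (fun x : R => sinc (d * x)).
Proof. exact: continuous_compR (@continuous_mulr _ d) continuous_sinc. Qed.

Lemma norm_mulr_le (M u v : R) : `|u| <= M -> `|v| <= 1 -> `|u * v| <= M.
Proof.
move=> uM v1; rewrite normrM (le_trans _ uM)// ler_piMr//.
Qed.

Lemma vanishes_sincM k (M d : R) : 0 < d -> (forall x, `|k x| <= M) ->
  vanishes_at_infinity (fun x => k x * sinc (d * x)).
Proof.
move=> d0 kM e e0; exists (`|M| / (d * e) + 1) => x xA.
have Me0 : 0 <= `|M| / (d * e) by rewrite divr_ge0// mulr_ge0// ltW.
have x0 : 0 < `|x| by rewrite (lt_le_trans _ xA)// ltr_wpDl.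
have dx0 : d * x != 0 by rewrite mulf_neq0//; [rewrite gt_eqF|rewrite -normr_gt0].
rewrite normrM (@le_trans _ _ (`|M| * `|d * x|^-1))//.
  by rewrite ler_pM// ?norm_sinc_le_inv// (le_trans (kM x))// ler_norm.
rewrite normrM (gtr0_norm d0) ler_pdivrMr ?mulr_gt0//.
rewrite mulrCA mulrA -ler_pdivrMl ?mulr_gt0// mulrC.
by rewrite (le_trans _ xA)// lerDl.
Qed.

(** sinc (d x) is the mean of cos (a x) over 0 <= a <= d, so an estimate uniform
    in a survives the averaging. *)
Lemma sinc_smoothing nu k (M d eta : R) :
  continuous k -> (forall x, `|k x| <= M) -> 0 <= d ->
  (forall a, 0 <= a <= d ->
    `|charge_Rintegral nu (fun x => k x * cos (a * x))
      - charge_Rintegral nu k| <= eta) ->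
  `|charge_Rintegral nu (fun x => k x * sinc (d * x))
    - charge_Rintegral nu k| <= eta.
Proof.
move=> ck kM d0 H.
have bk := continuous_bounded_measurable ck kM.
pose a n j : R := (j.*2.+1)%:R * (d / n.+1.*2%:R).
have bka n j : bounded_measurable ((fun x : R => k x * cos (a n j * x)) : T -> R).
  by apply: bounded_measurableM => //; exact: bounded_measurable_cosZ.
have kmE n : (fun x => k x * mean_cos d n x) =
    (fun x => n.+1%:R^-1 * \sum_(0 <= j < n.+1) k x * cos (a n j * x)).
  by apply/funext => x; rewrite /mean_cos mulrCA mulr_sumr.
have Hn n : `|charge_Rintegral nu (fun x => k x * mean_cos d n x)
    - charge_Rintegral nu k| <= eta.
  rewrite kmE charge_RintegralZ; last exact: bounded_measurable_sum.
  rewrite charge_Rintegral_sum//.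
  have -> : charge_Rintegral nu k =
      n.+1%:R^-1 * \sum_(0 <= j < n.+1) charge_Rintegral nu k.
    rewrite big_const_nat subn0 iter_addr_0 -(mulr_natl (charge_Rintegral nu k)).
    by rewrite mulKf// pnatr_eq0.
  rewrite -mulrBr -sumrB normrM gtr0_norm ?invr_gt0// ler_pdivrMl//.
  rewrite (le_trans (ler_norm_sum _ _ _))//.
  rewrite (@le_trans _ _ (\sum_(0 <= j < n.+1) eta))//; last first.
    by rewrite big_const_nat subn0 iter_addr_0 mulr_natl.
  rewrite big_nat_cond [leRHS]big_nat_cond; apply: ler_sum => j /andP[/andP[_ jn] _].
  apply: H; rewrite /a; apply/andP; split.
    by rewrite mulr_ge0// divr_ge0.
  rewrite mulrCA ler_piMr// ler_pdivrMr// mul1r ler_nat doubleS.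
  by rewrite (leq_trans _ (leqnSn _))// ltnS leq_double -ltnS.
have c : charge_Rintegral nu (fun x => k x * mean_cos d n x) @[n --> \oo] -->
    charge_Rintegral nu (fun x => k x * sinc (d * x)).
  apply: (@charge_Rintegral_cvg _ T R nu _ _ M).
  - move=> n; rewrite kmE.
    by have [] := bounded_measurableZ n.+1%:R^-1
      (bounded_measurable_sum (index_iota 0 n.+1) (bka n)).
  - apply: continuous_measurable_fun; apply: continuousM_fun => //.
    exact: continuous_sincZ.
  - by move=> n x; apply: norm_mulr_le => //; exact: norm_mean_cos_le1.
  - by move=> x; apply: cvgM; [exact: cvg_cst|exact: cvg_mean_cos].
have {}c : `|charge_Rintegral nu (fun x => k x * mean_cos d n x)
      - charge_Rintegral nu k| @[n --> \oo] -->
    `|charge_Rintegral nu (fun x => k x * sinc (d * x)) - charge_Rintegral nu k|.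
  by apply: cvg_norm; apply: cvgB => //; exact: cvg_cst.
rewrite -(cvg_lim _ c)//; apply: limr_le; first by apply: cvgP c.
exact: nearW.
Qed.

End smoothing.

Section smoothed_convergence.
Context {R : realType}.
Local Notation T := (measurableTypeR R).

(** Mass of the charges may escape to infinity, so basic convergence by itself says
    nothing about a kernel k that does not vanish there. If small modulations of k
    are harmless uniformly in n, then k may be multiplied by sinc (d x), which makes
    it vanish at infinity, and this factor is removed by letting d tend to 0 under
    the limit charge only. *)
Lemma modulation_charge_Rintegral_cvg (Gn : nat -> R -> R) (G : R -> R)
    (nun : nat -> {charge set T -> \bar R}) (nu : {charge set T -> \bar R})
    (K M : R) (D : set R) (k : R -> R) :
  (forall n, right_continuous (Gn n)) -> right_continuous G ->
  (forall n, (total_variation_line (Gn n) <= K%:E)%E) ->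
  (total_variation_line G <= K%:E)%E ->
  (forall n, is_stieltjes_charge (Gn n) (nun n)) -> is_stieltjes_charge G nu ->
  countable D ->
  (forall x1 x2, ~ D x1 -> ~ D x2 ->
    Gn n x2 - Gn n x1 @[n --> \oo] --> G x2 - G x1) ->
  continuous k -> (forall x, `|k x| <= M) ->
  (forall e, 0 < e -> exists2 d, 0 < d & \forall n \near \oo,
    forall a, 0 <= a <= d ->
      `|charge_Rintegral (nun n) (fun x => k x * cos (a * x))
        - charge_Rintegral (nun n) k| <= e) ->
  charge_Rintegral (nun n) k @[n --> \oo] --> charge_Rintegral nu k.
Proof.
move=> Gnrc Grc GnK GK nunG nuG cD Gcvg ck kM H.
apply/cvgrPdist_le => e e0.
have e30 : 0 < e / 3 by rewrite divr_gt0.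
have [d0 d00 Hd0] := H _ e30.
have c : charge_Rintegral nu (fun x => k x * sinc (m.+1%:R^-1 * x)) @[m --> \oo]
    --> charge_Rintegral nu k.
  apply: (@charge_Rintegral_cvg _ T R nu _ _ M).
  - move=> m; apply: continuous_measurable_fun.
    by apply: continuousM_fun => //; exact: continuous_sincZ.
  - exact: continuous_measurable_fun.
  - by move=> m x; apply: norm_mulr_le => //; exact: norm_sinc_le1.
  - move=> x; rewrite -[X in _ --> X]mulr1.
    by apply: cvgM; [exact: cvg_cst|exact: cvg_sinc1].
move/cvgrPdist_le : c => /(_ _ e30) c.
have c0 : \forall m \near \oo, m.+1%:R^-1 <= d0.
  have /cvgrPdist_le /(_ _ d00) := @cvg_harmonic R.
  by apply: filterS => m; rewrite sub0r normrN /harmonic/= ger0_norm ?invr_ge0.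
have [m [cm md0]] := filter_ex (filterI c c0).
pose d := m.+1%:R^-1 : R.
have d_gt0 : 0 < d by rewrite invr_gt0.
have ckd : continuous (fun x => k x * sinc (d * x)).
  by apply: continuousM_fun => //; exact: continuous_sincZ.
have kdM x : `|k x * sinc (d * x)| <= M.
  by apply: norm_mulr_le => //; exact: norm_sinc_le1.
have := basic_cvg_charge_Rintegral Gnrc Grc GnK GK nunG nuG cD Gcvg ckd kdM
  (vanishes_sincM d_gt0 kM).
move=> /cvgrPdist_le /(_ _ e30) Helly.
near=> n.
have h1 : `|charge_Rintegral (nun n) (fun x => k x * sinc (d * x))
    - charge_Rintegral (nun n) k| <= e / 3.
  apply: (sinc_smoothing ck kM (ltW d_gt0)) => a /andP[a0 ad].
  have Hn : forall a, 0 <= a <= d0 ->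
      `|charge_Rintegral (nun n) (fun x => k x * cos (a * x))
        - charge_Rintegral (nun n) k| <= e / 3 by near: n; exact: Hd0.
  by apply: Hn; rewrite a0 (le_trans ad).
have h2 : `|charge_Rintegral nu (fun x => k x * sinc (d * x))
    - charge_Rintegral (nun n) (fun x => k x * sinc (d * x))| <= e / 3.
  by near: n; exact: Helly.
have -> : charge_Rintegral nu k - charge_Rintegral (nun n) k
  = (charge_Rintegral nu k - charge_Rintegral nu (fun x => k x * sinc (d * x)))
  + (charge_Rintegral nu (fun x => k x * sinc (d * x))
      - charge_Rintegral (nun n) (fun x => k x * sinc (d * x)))
  + (charge_Rintegral (nun n) (fun x => k x * sinc (d * x))
      - charge_Rintegral (nun n) k) by ring.
rewrite (_ : e = e / 3 + e / 3 + e / 3); last by field.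
by rewrite (le_trans (ler_normD _ _))// lerD// (le_trans (ler_normD _ _))// lerD.
Unshelve. all: by end_near. Qed.

End smoothed_convergence.

(** * The spectral kernel *)

Section spectral_kernel.
Context {R : realType}.
Implicit Types (tau t x a : R).

Definition re_kernel t x : R :=
  if x == 0 then - (t ^+ 2 / 2) else (cos (t * x) - 1) * ((1 + x ^+ 2) / x ^+ 2).

Definition im_kernel tau t x : R :=
  if x == 0 then 0
  else (sin (t * x) - t / tau * sin (tau * x)) * ((1 + x ^+ 2) / x ^+ 2).

Lemma Re_spectral_kernel tau t x :
  complex.Re (spectral_kernel tau t x) = re_kernel t x.
Proof.
rewrite /spectral_kernel /re_kernel; case: ifP => //= _.
by rewrite /cexp /= expR0; move: ((1 + _) / _) => r; ring.
Qed.

Lemma Im_spectral_kernel tau t x :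
  complex.Im (spectral_kernel tau t x) = im_kernel tau t x.
Proof.
rewrite /spectral_kernel /im_kernel; case: ifP => //= _.
by rewrite /cexp /= expR0; move: ((1 + _) / _) => r; ring.
Qed.

(** Half the usual second difference. *)
Definition second_difference (f : R -> R) t a : R := (f (t + a) + f (t - a)) / 2 - f t.

(** Modulating the kernel in x amounts to averaging it over t + a and t - a. The
    terms making the kernel integrable at x = 0 are not modulated, and are
    compensated by the same average at the point where the kernel vanishes
    identically: t = 0 for the real part, t = tau for the imaginary part. *)
Lemma re_kernel_cosM t x a :
  re_kernel t x * cos (a * x) - re_kernel t x
  = second_difference (re_kernel ^~ x) t a - second_difference (re_kernel ^~ x) 0 a.
Proof.
rewrite /second_difference /re_kernel; case: eqP => [->|x0].
  by rewrite mulr0 cos0; field.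
rewrite sub0r add0r mul0r cos0 ![(_ + _) * x]mulrDl !mulNr cosN cosB cosD.
by move: ((1 + _) / _) => r; field.
Qed.

Lemma im_kernel_cosM tau t x a : tau != 0 ->
  im_kernel tau t x * cos (a * x) - im_kernel tau t x
  = second_difference (im_kernel tau ^~ x) t a
    - t / tau * second_difference (im_kernel tau ^~ x) tau a.
Proof.
move=> tau0; rewrite /second_difference /im_kernel; case: eqP => [_|x0].
  by rewrite mul0r; field.
rewrite ![(_ + _) * x]mulrDl !mulNr !sinB !sinD.
by move: ((1 + _) / _) => r; field.
Qed.

Lemma norm_re_kernel_le t x : `|re_kernel t x| <= t ^+ 2 + 4.
Proof.
rewrite /re_kernel; case: eqP => [_|/eqP x0].
  rewrite normrN ger0_norm ?divr_ge0 ?sqr_ge0//.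
  by have := sqr_ge0 t; lra.
have x20 : 0 < x ^+ 2 by rewrite exprn_even_gt0.
rewrite normrM [`|_ / _|]ger0_norm ?divr_ge0 ?addr_ge0 ?sqr_ge0//.
rewrite mulrA ler_pdivrMr//.
have h1 := norm_cosB1_le (t * x).
have h2 : `|cos (t * x) - 1| <= 2.
  by rewrite (le_trans (ler_normB _ _))// normr1; have := cos_max (t * x); lra.
rewrite exprMn in h1.
have := normr_ge0 (cos (t * x) - 1); have := sqr_ge0 t.
move: (`|_|) (t ^+ 2) (x ^+ 2) x20 h1 h2 => c p q q0 h1 h2 p0 c0.
have pq0 : 0 <= p * q by rewrite mulr_ge0// ltW.
have [q1|q1] := leP q 1.
  have : 0 <= c * (1 - q) by rewrite mulr_ge0// subr_ge0.
  lra.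
have : 0 <= (2 - c) * (1 + q) by rewrite mulr_ge0// ?subr_ge0// addr_ge0// ltW.
lra.
Qed.

Definition im_kernel_bound tau t : R :=
  2 * (1 + `|t| / tau) + (`|t| ^+ 3 + `|t| * tau ^+ 2) / 3.

(** The linear terms t x cancel, which leaves the cubic remainders of both sines. *)
Lemma norm_im_numerator_le tau t x : 0 < tau ->
  `|sin (t * x) - t / tau * sin (tau * x)|
  <= (`|t| ^+ 3 + `|t| * tau ^+ 2) / 6 * `|x| ^+ 3.
Proof.
move=> tau0.
have -> : sin (t * x) - t / tau * sin (tau * x)
    = (sin (t * x) - t * x) - t / tau * (sin (tau * x) - tau * x).
  by field; rewrite gt_eqF.
rewrite (le_trans (ler_normB _ _))//.
rewrite mulrDl mulrDl; apply: lerD.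
  by rewrite (le_trans (norm_sinB_id_le _))// normrM exprMn mulrAC.
rewrite normrM.
have := norm_sinB_id_le (tau * x); rewrite !normrM normfV (gtr0_norm tau0) exprMn.
move=> h; have tt0 : 0 <= `|t| / tau by rewrite divr_ge0// ltW.
apply: le_trans (ler_wpM2l tt0 h) _.
rewrite (_ : _ / _ * _ = `|t| * tau ^+ 2 / 6 * `|x| ^+ 3)//.
by field; rewrite gt_eqF.
Qed.

Lemma norm_im_kernel_le tau t x : 0 < tau ->
  `|im_kernel tau t x| <= im_kernel_bound tau t.
Proof.
move=> tau0; have b1 : 0 <= `|t| / tau by rewrite divr_ge0// ltW.
have b2 : 0 <= (`|t| ^+ 3 + `|t| * tau ^+ 2) / 3.
  by rewrite divr_ge0// addr_ge0// ?exprn_ge0// mulr_ge0// sqr_ge0.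
rewrite /im_kernel /im_kernel_bound; case: eqP => [_|/eqP x0].
  by rewrite normr0; lra.
have x20 : 0 < x ^+ 2 by rewrite exprn_even_gt0.
rewrite normrM [`|_ / _|]ger0_norm ?divr_ge0 ?addr_ge0 ?sqr_ge0//.
have [x1|x1] := leP `|x| 1.
  rewrite mulrA ler_pdivrMr//.
  have h := norm_im_numerator_le t x tau0.
  have x21 : x ^+ 2 <= 1 by rewrite -real_normK ?num_real// expr_le1.
  have x3 : `|x| ^+ 3 <= x ^+ 2.
    by rewrite exprS real_normK ?num_real// ler_piMl// sqr_ge0.
  set C := _ / 6 in h; have C0 : 0 <= C.
    by rewrite divr_ge0// addr_ge0// ?exprn_ge0// mulr_ge0// sqr_ge0.
  have -> : (`|t| ^+ 3 + `|t| * tau ^+ 2) / 3 = 2 * C by rewrite /C; field.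
  have {}h : `|sin (t * x) - t / tau * sin (tau * x)| <= C * x ^+ 2.
    by rewrite (le_trans h)// ler_wpM2l.
  have := normr_ge0 (sin (t * x) - t / tau * sin (tau * x)).
  move: `|_ - _| h => s h s0; move: (`|t| / tau) b1 => r r0.
  move: (x ^+ 2) C C0 x20 x21 x3 h => q C C0 q0 q1 _ h.
  have : 0 <= C * (q * (1 - q)) by rewrite !mulr_ge0// ?subr_ge0// ltW.
  have : 0 <= (C * q - s) * (1 + q) by rewrite mulr_ge0// ?subr_ge0// addr_ge0// ltW.
  have : 0 <= r * q by rewrite mulr_ge0// ltW.
  lra.
have h : `|sin (t * x) - t / tau * sin (tau * x)| <= 1 + `|t| / tau.
  rewrite (le_trans (ler_normB _ _))// lerD ?sin_max// !normrM normfV (gtr0_norm tau0).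
  by rewrite ler_piMr// sin_max.
have r2 : (1 + x ^+ 2) / x ^+ 2 <= 2.
  rewrite ler_pdivrMr//.
  have : 1 <= x ^+ 2 by rewrite -real_normK ?num_real// expr_ge1// ltW.
  lra.
rewrite (@le_trans _ _ (2 * (1 + `|t| / tau)))//; last by rewrite lerDl.
rewrite mulrC ler_pM// divr_ge0// ?addr_ge0// ?sqr_ge0//.
Qed.

Lemma continuous_kernel_weight x : x != 0 ->
  {for x, continuous (fun x => (1 + x ^+ 2) / x ^+ 2)}.
Proof.
move=> x0; apply: cvgM; first by apply: cvgD; [exact: cvg_cst|exact: exprn_continuous].
by apply: cvgV; [rewrite expf_neq0|exact: exprn_continuous].
Qed.

Lemma continuous_re_kernel t : continuous (re_kernel t).
Proof.
apply: (@continuous_patch0 _ _ _ (t ^+ 2 / 2 + t ^+ 4 / 24)) => [x x0|x x0 x1].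
  apply: cvgM; last exact: continuous_kernel_weight.
  by apply: cvgB; [exact: continuous_cosZ|exact: cvg_cst].
have x20 : 0 < x ^+ 2 by rewrite exprn_even_gt0.
have -> : (cos (t * x) - 1) * ((1 + x ^+ 2) / x ^+ 2) - - (t ^+ 2 / 2)
    = (cos (t * x) - 1) + (cos (t * x) - 1 + (t * x) ^+ 2 / 2) / x ^+ 2.
  by field.
have x2x : x ^+ 2 <= `|x| by rewrite -real_normK ?num_real// expr2 ler_piMl.
rewrite (le_trans (ler_normD _ _))// [leRHS]mulrDl lerD//.
  rewrite (le_trans (norm_cosB1_le _))// exprMn mulrAC ler_wpM2l//.
  by rewrite divr_ge0// sqr_ge0.
rewrite normrM [`|_^-1|]gtr0_norm ?invr_gt0// ler_pdivrMr//.
rewrite (le_trans (norm_cos_parabola_le _))//.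
rewrite (_ : _ / 24 = t ^+ 4 / 24 * x ^+ 2 * x ^+ 2); last by field.
rewrite ler_wpM2r ?sqr_ge0// ler_wpM2l// divr_ge0//.
by rewrite -[4%N]/(2 * 2)%N exprM sqr_ge0.
Qed.

Lemma continuous_im_kernel tau t : 0 < tau -> continuous (im_kernel tau t).
Proof.
move=> tau0; pose C := (`|t| ^+ 3 + `|t| * tau ^+ 2) / 6.
apply: (@continuous_patch0 _ _ _ (C * 2)) => [x x0|x x0 x1].
  apply: cvgM; last exact: continuous_kernel_weight.
  apply: cvgB; first exact: continuous_sinZ.
  by apply: cvgM; [exact: cvg_cst|exact: continuous_sinZ].
have x20 : 0 < x ^+ 2 by rewrite exprn_even_gt0.
rewrite subr0 normrM [`|_ / _|]ger0_norm ?divr_ge0 ?addr_ge0 ?sqr_ge0//.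
rewrite mulrA ler_pdivrMr//.
have h := norm_im_numerator_le t x tau0; rewrite -/C exprS real_normK ?num_real// in h.
apply: le_trans (ler_wpM2r _ h) _; first by rewrite addr_ge0// sqr_ge0.
have C0 : 0 <= C.
  by rewrite divr_ge0// addr_ge0// ?exprn_ge0// mulr_ge0// sqr_ge0.
have x21 : x ^+ 2 <= 1 by rewrite -real_normK ?num_real// expr_le1.
rewrite (_ : C * 2 * `|x| * x ^+ 2 = C * (`|x| * x ^+ 2) * 2); last by ring.
rewrite ler_wpM2l//; last by lra.
by rewrite mulr_ge0// mulr_ge0// sqr_ge0.
Qed.

End spectral_kernel.

(** * Logarithms of characteristic functions *)

Section polar.
Context {R : realType}.
Implicit Types (u v w z e c d : R).

(** In polar coordinates the squared distance splits into a radial and an angular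
    part, and each is bounded by the whole. *)
Lemma polar_distance u v w z eta c : 0 < c -> c <= expR u -> c <= expR v ->
  `|expR u * cos w - expR v * cos z| <= c * eta ->
  `|expR u * sin w - expR v * sin z| <= c * eta ->
  `|u - v| <= 2 * eta /\ 1 - cos (w - z) <= eta ^+ 2.
Proof.
move=> c0 cu cv hc hs.
have eta0 : 0 <= eta by rewrite -(pmulr_rge0 _ c0) (le_trans (normr_ge0 _) hc).
have split : (expR u * cos w - expR v * cos z) ^+ 2
    + (expR u * sin w - expR v * sin z) ^+ 2
    = (expR u - expR v) ^+ 2 + 2 * (expR u * expR v) * (1 - cos (w - z)).
  rewrite cosB; have := cos2Dsin2 w; have := cos2Dsin2 z.
  move: (expR u) (expR v) (cos w) (sin w) (cos z) (sin z) => p q a b a' b' h1 h2.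
  transitivity (p ^+ 2 * (a ^+ 2 + b ^+ 2) + q ^+ 2 * (a' ^+ 2 + b' ^+ 2)
    - 2 * p * q * (a * a' + b * b')); first by ring.
  by rewrite h1 h2; ring.
have sq x : `|x| <= c * eta -> x ^+ 2 <= (c * eta) ^+ 2.
  by move=> h; rewrite -real_normK ?num_real// lerXn2r ?nnegrE// mulr_ge0// ltW.
have := sq _ hc; have := sq _ hs => hs2 hc2.
have ang0 : 0 <= 1 - cos (w - z) by rewrite subr_ge0 cos_le1.
have u0 := expR_gt0 u; have v0 := expR_gt0 v.
have ang : 0 <= 2 * (expR u * expR v) * (1 - cos (w - z)) by rewrite !mulr_ge0// ltW.
split; last first.
  have : 2 * (c * c) * (1 - cos (w - z)) <= 2 * (expR u * expR v) * (1 - cos (w - z)).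
    by rewrite ler_wpM2r// ler_wpM2l// ler_pM// ltW.
  move=> h; have := sqr_ge0 (expR u - expR v) => h0.
  have h3 : 2 * (c * c) * (1 - cos (w - z)) <= 2 * (c * c) * eta ^+ 2.
    rewrite exprMn in hs2 hc2; lra.
  by rewrite ler_pM2l// !mulr_gt0 in h3.
have rad : `|expR u - expR v| <= 2 * (c * eta).
  have ce0 : 0 <= c * eta by rewrite mulr_ge0// ltW.
  have h4 : `|expR u - expR v| ^+ 2 <= (2 * (c * eta)) ^+ 2.
    rewrite real_normK ?num_real// [leRHS]exprMn.
    by have := sqr_ge0 (c * eta); lra.
  have ce20 : 0 <= 2 * (c * eta) by rewrite mulr_ge0.
  by rewrite -(@ler_pXn2r _ 2)// nnegrE.
have log x y : c <= expR y -> expR x - expR y <= 2 * (c * eta) -> x - y <= 2 * eta.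
  move=> cy h; rewrite -(lerD2l 1) (le_trans (expR_ge1Dx _))//.
  rewrite expRD expRN ler_pdivrMr ?expR_gt0// mulrDl mul1r -lerBlDl (le_trans h)//.
  by rewrite -mulrA ler_wpM2l// mulrC ler_wpM2l.
rewrite ler_norml lerNl opprB; apply/andP; split; apply: log => //.
  by rewrite (le_trans (ler_norm _))// distrC.
by rewrite (le_trans (ler_norm _)).
Qed.

Lemma cos_lt1 e : 0 < e <= 1 -> cos e < 1.
Proof.
move=> /andP[e0 e1]; apply: le_lt_trans (cos_le_quartic e) _.
have e20 : 0 < e ^+ 2 by rewrite exprn_gt0.
have e21 : e ^+ 2 <= 1 by rewrite expr_le1// ltW.
have : (e ^+ 2) ^+ 2 <= e ^+ 2 by rewrite expr2 ler_piMr// ltW.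
by rewrite -exprM; lra.
Qed.

(** A continuous argument cannot wind around the circle without crossing the
    excluded angle. *)
Lemma continuous_argument_small (g : R -> R) d e : continuous g -> g 0 = 0 ->
  0 < e -> (forall a, `|a| <= d -> cos e < cos (g a)) ->
  forall a, `|a| <= d -> `|g a| <= e.
Proof.
move=> cg g0 e0 ge a ad; rewrite leNgt; apply/negP => ega.
have cng : continuous (fun x => `|g x|) by move=> x; apply: cvg_norm; exact: cg.
have [b bd gb] : exists2 b, `|b| <= d & `|g b| = e.
  have [a0|a0] := leP 0 a.
    have [||b] := @IVT R (fun x => `|g x|) 0 a e a0.
    - exact: continuous_subspaceT.
    - by rewrite /= g0 normr0 ge_min le_max (ltW e0) (ltW ega) orbT.
    - rewrite in_itv/= => /andP[b0 ba] gb; exists b => //.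
      by rewrite ger0_norm// (le_trans ba)// (le_trans (ler_norm a)).
  have [||b] := @IVT R (fun x => `|g x|) a 0 e (ltW a0).
  - exact: continuous_subspaceT.
  - by rewrite /= g0 normr0 ge_min le_max (ltW e0) (ltW ega) orbT.
  - rewrite in_itv/= => /andP[ab b0] gb; exists b => //.
    by rewrite ler0_norm// (le_trans _ ad)// ltr0_norm// lerN2.
by have := ge _ bd; rewrite -(cos_norm (g b)) gb ltxx.
Qed.

End polar.

Section characteristic_functions.
Context {R : realType}.
Local Notation T := (measurableTypeR R).
Implicit Types (F : cumulativeBounded (0 : R) (1 : R)).

Definition re_char F t : R :=
  Rintegral (lebesgue_stieltjes_measure F) setT (fun x : R => cos (t * x)).

Definition im_char F t : R :=
  Rintegral (lebesgue_stieltjes_measure F) setT (fun x : R => sin (t * x)).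

Lemma char_funE F t : char_fun F t = Complex (re_char F t) (im_char F t).
Proof.
rewrite /char_fun /Cintegral; congr Complex; apply: eq_Rintegral => x _ /=;
  by rewrite expR0; ring.
Qed.

Lemma cexpE (u w : R) : cexp (Complex u w) = Complex (expR u * cos w) (expR u * sin w).
Proof. by rewrite /cexp /=; congr Complex; ring. Qed.

Definition re_log (nu : {charge set T -> \bar R}) t :=
  charge_Rintegral nu (re_kernel t).

Definition im_log tau (nu : {charge set T -> \bar R}) t :=
  charge_Rintegral nu (im_kernel tau t).

Lemma spectral_exponentE tau gamma (nu : {charge set T -> \bar R}) t :
  (Complex 0 (t * gamma) + charge_Cintegral nu (spectral_kernel tau t))%R
  = Complex (re_log nu t) (t * gamma + im_log tau nu t).
Proof.
rewrite /charge_Cintegral.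
have -> : (fun x => complex.Re (spectral_kernel tau t x)) = re_kernel t.
  by apply/funext => x; rewrite Re_spectral_kernel.
have -> : (fun x => complex.Im (spectral_kernel tau t x)) = im_kernel tau t.
  by apply/funext => x; rewrite Im_spectral_kernel.
by rewrite -[LHS]/(Complex (0 + re_log nu t) (t * gamma + im_log tau nu t)) add0r.
Qed.

Lemma spectral_pairP tau F gamma G : spectral_pair tau F gamma G <->
  class_V G /\ exists2 nu, is_stieltjes_charge G nu & forall t,
    re_char F t = expR (re_log nu t) * cos (t * gamma + im_log tau nu t) /\
    im_char F t = expR (re_log nu t) * sin (t * gamma + im_log tau nu t).
Proof.
split=> -[GV [nu nuG H]]; split=> //; exists nu => // t.
  have := H t; rewrite char_funE.
  have -> : ((t * gamma) *i + charge_Cintegral nu (spectral_kernel tau t))%C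
      = Complex (re_log nu t) (t * gamma + im_log tau nu t).
    exact: spectral_exponentE.
  by rewrite cexpE => -[].
have [re im] := H t; rewrite char_funE re im -cexpE; congr cexp.
by apply/esym; exact: spectral_exponentE.
Qed.

Lemma continuous_minl (c : R) : continuous (fun y : R => Num.min c y).
Proof.
move=> y; apply: (@continuous_min _ _ (fun=> c) (fun y : R => y) y).
  exact: cvg_cst.
exact: cvg_id.
Qed.

Lemma continuous_min2 (d : R) : continuous (fun x : R => Num.min 2 (d * `|x|)).
Proof.
apply: (@continuous_compR _ (fun x => d * `|x|) (Num.min 2)) => [x|].
  by apply: cvgM; [exact: cvg_cst|exact: norm_continuous].
exact: continuous_minl.
Qed.

Lemma norm_min2_le (d x : R) : 0 <= d -> `|Num.min 2 (d * `|x|)| <= 2.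
Proof.
move=> d0; have m0 : 0 <= Num.min 2 (d * `|x|) by rewrite le_min mulr_ge0 ?ler0n.
by rewrite ger0_norm// ge_min lexx.
Qed.

Lemma char_modulus F t s d : `|t - s| <= d ->
  `|re_char F t - re_char F s| <=
    Rintegral (lebesgue_stieltjes_measure F) setT (fun x => Num.min 2 (d * `|x|)) /\
  `|im_char F t - im_char F s| <=
    Rintegral (lebesgue_stieltjes_measure F) setT (fun x => Num.min 2 (d * `|x|)).
Proof.
move=> tsd; have d0 : 0 <= d by exact: le_trans tsd.
have bm : bounded_measurable ((fun x : R => Num.min 2 (d * `|x|)) : T -> R).
  by apply: continuous_bounded_measurable => [|x];
    [exact: continuous_min2|exact: norm_min2_le].
have bc u := @bounded_measurable_cosZ R u.
have mle x : Num.min 2 `|t * x - s * x| <= Num.min 2 (d * `|x|).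
  by rewrite le_min !ge_min lexx /= -mulrBl normrM ler_wpM2r ?orbT.
split.
  rewrite -(@bounded_RintegralB _ _ _ (lebesgue_stieltjes_measure F))//.
  apply: bounded_le_norm_Rintegral => //; first exact: bounded_measurableB.
  by move=> x; apply: le_trans (norm_cosB_le _ _) (mle x).
rewrite -(@bounded_RintegralB _ _ _ (lebesgue_stieltjes_measure F));
  try exact: bounded_measurable_sin.
apply: bounded_le_norm_Rintegral => //.
  by apply: bounded_measurableB; exact: bounded_measurable_sin.
by move=> x; apply: le_trans (norm_sinB_le _ _) (mle x).
Qed.

(** The majorant of the modulus of continuity is itself the integral of a bounded
    continuous function, so weak convergence alone makes it uniform. *)
Lemma weak_cvg_equicontinuous (Fn : nat -> cumulativeBounded (0 : R) (1 : R)) F eta :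
  weak_cvg Fn F -> 0 < eta ->
  exists2 d, 0 < d & \forall n \near \oo, forall t s, `|t - s| <= d ->
    `|re_char (Fn n) t - re_char (Fn n) s| <= eta /\
    `|im_char (Fn n) t - im_char (Fn n) s| <= eta.
Proof.
move=> wF eta0; have eta20 : 0 < eta / 2 by rewrite divr_gt0.
pose mu : {finite_measure set T -> \bar R} := lebesgue_stieltjes_measure F.
pose h m (x : R) : R := Num.min 2 (m.+1%:R^-1 * `|x|).
have c : Rintegral mu setT (h m) @[m --> \oo] --> Rintegral mu setT (fun=> 0).
  apply: (@bounded_Rintegral_cvg _ T R mu _ _ 2).
  - by move=> m; apply: continuous_measurable_fun; exact: continuous_min2.
  - exact: measurable_cst.
  - by move=> m x; apply: norm_min2_le; rewrite invr_ge0.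
  - move=> x; rewrite -[X in _ --> X](min_idPr (ler0n R 2)).
    apply: continuous_cvg; first exact: continuous_minl.
    rewrite -[X in _ --> X](mul0r `|x|).
    by apply: cvgM; [exact: cvg_harmonic|exact: cvg_cst].
rewrite Rintegral_cst// mul0r in c.
have [m hm] : exists m, Rintegral mu setT (h m) <= eta / 2.
  move/cvgrPdist_le : c => /(_ _ eta20) /filter_ex [m].
  by rewrite sub0r normrN => hm; exists m; exact: le_trans (ler_norm _) hm.
exists m.+1%:R^-1; first by rewrite invr_gt0.
have hM : exists M, forall x, `|h m x| <= M.
  by exists 2 => x; apply: norm_min2_le; rewrite invr_ge0.
have /cvgrPdist_le /(_ _ eta20) := wF (h m) (@continuous_min2 _) hM.
apply: filterS => n hn t s ts.
have hneta : Rintegral (lebesgue_stieltjes_measure (Fn n)) setT (h m) <= eta.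
  move: hn hm; rewrite ler_distl => /andP[+ _].
  by rewrite /mu; move: (Rintegral _ _ _) (Rintegral _ _ _) => u v; lra.
have [hc hs] := char_modulus (Fn n) ts.
by split; [exact: le_trans hc hneta|exact: le_trans hs hneta].
Qed.

(** The modulus of exp (U + i W) is bounded below on compact sets, so
    equicontinuity passes to the polar coordinates locally, and the continuity of W
    excludes jumps by multiples of 2 pi. *)
Lemma log_equicontinuous (Fn : nat -> cumulativeBounded (0 : R) (1 : R)) F
    (U W : nat -> R -> R) :
  weak_cvg Fn F ->
  (forall n t, re_char (Fn n) t = expR (U n t) * cos (W n t)) ->
  (forall n t, im_char (Fn n) t = expR (U n t) * sin (W n t)) ->
  (forall n, continuous (W n)) ->
  (forall L, exists B, forall n t, `|t| <= L -> B <= U n t) ->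
  forall L e, 0 < e -> exists2 d, 0 < d & \forall n \near \oo,
    forall t a, `|t| <= L -> `|a| <= d ->
      `|U n (t + a) - U n t| <= e /\ `|W n (t + a) - W n t| <= e.
Proof.
move=> wF reE imE cW Ulb L e e0.
have [B UB] := Ulb (L + 1).
pose e1 := Num.min e 1.
have e10 : 0 < e1 by rewrite lt_min e0/=.
have ce1 : cos e1 < 1 by apply: cos_lt1; rewrite e10/= ge_min lexx orbT.
pose eta := Num.min (e1 / 2) ((1 - cos e1) / 2).
have eta0 : 0 < eta by rewrite lt_min !divr_gt0//= subr_gt0.
have etae : 2 * eta <= e.
  have : eta <= e1 / 2 by rewrite ge_min lexx.
  have : e1 <= e by rewrite ge_min lexx.
  lra.
have etac : eta ^+ 2 < 1 - cos e1.
  have h : eta <= (1 - cos e1) / 2 by rewrite ge_min lexx orbT.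
  have := cos_geN1 e1; move: (cos e1) ce1 h => q q1 h qN1.
  have : eta * eta <= eta * 1 by rewrite ler_wpM2l ?(ltW eta0)//; lra.
  by rewrite expr2; lra.
have [d d0 Hd] := weak_cvg_equicontinuous wF (mulr_gt0 (expR_gt0 B) eta0).
exists (Num.min d 1); first by rewrite lt_min d0/=.
near=> n => t a tL; rewrite le_min => /andP[ad a1].
have Hn : forall t s, `|t - s| <= d ->
    `|re_char (Fn n) t - re_char (Fn n) s| <= expR B * eta /\
    `|im_char (Fn n) t - im_char (Fn n) s| <= expR B * eta.
  by near: n; exact: Hd.
have key b : `|b| <= Num.min d 1 ->
    `|U n (t + b) - U n t| <= 2 * eta /\ 1 - cos (W n (t + b) - W n t) <= eta ^+ 2.
  rewrite le_min => /andP[bd b1].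
  have := Hn (t + b) t; rewrite addrAC subrr add0r => /(_ bd).
  rewrite !reE !imE => -[hc hs].
  apply: polar_distance hc hs; rewrite ?expR_gt0// ler_expR; apply: UB.
    by rewrite (le_trans (ler_normD _ _))// lerD.
  by rewrite (le_trans tL)// lerDl.
have ad1 : `|a| <= Num.min d 1 by rewrite le_min ad.
split; first by have [h _] := key a ad1; exact: le_trans h etae.
apply: (@le_trans _ _ e1); last by rewrite ge_min lexx.
apply: (@continuous_argument_small R (fun b => W n (t + b) - W n t)
  (Num.min d 1)) => //.
- move=> b; apply: cvgB; last exact: cvg_cst.
  apply: (@continuous_compR _ (fun b => t + b) (W n)) => // z.
  by apply: cvgD; [exact: cvg_cst|exact: cvg_id].
- by rewrite addr0 subrr.
- by move=> b /key[_]; lra.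
Unshelve. all: by end_near. Qed.

(** By the addition formula the integrals of cos (t x + c) are linear combinations
    of the two parts of the characteristic function. *)
Lemma eq_char_Rintegral F1 F2 (h : R -> R) M :
  (forall t, re_char F1 t = re_char F2 t /\ im_char F1 t = im_char F2 t) ->
  continuous h -> (forall x, `|h x| <= M) ->
  Rintegral (lebesgue_stieltjes_measure F1) setT h
  = Rintegral (lebesgue_stieltjes_measure F2) setT h.
Proof.
move=> charE ch hM; apply: (@eq_Rintegral_of_cos R
  (lebesgue_stieltjes_measure F1) (lebesgue_stieltjes_measure F2) h M) => // t c.
have bcos := bounded_measurable_cosZ t.
have bsin := bounded_measurable_sin t.
have E F : Rintegral (lebesgue_stieltjes_measure F) setT (fun x : R => cos (t * x + c))
    = cos c * re_char F t - sin c * im_char F t.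
  rewrite -!(@bounded_RintegralZ _ _ _ (lebesgue_stieltjes_measure F))//.
  rewrite -(@bounded_RintegralB _ _ _ (lebesgue_stieltjes_measure F)).
  - by apply: eq_Rintegral => x _; rewrite cosD; ring.
  - exact: bounded_measurableZ.
  - exact: bounded_measurableZ.
by have [re im] := charE t; rewrite !E re im.
Qed.

End characteristic_functions.

(** * Convergence of the logarithms *)

Section logarithm_convergence.
Context {R : realType}.
Local Notation T := (measurableTypeR R).
Implicit Types (F : cumulativeBounded (0 : R) (1 : R))
  (nu : {charge set T -> \bar R}).

Lemma bounded_measurable_re_kernel t : bounded_measurable (re_kernel t : T -> R).
Proof.
apply: (@continuous_bounded_measurable _ _ (t ^+ 2 + 4)) => [|x].
  exact: continuous_re_kernel.
exact: norm_re_kernel_le.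
Qed.

Lemma bounded_measurable_im_kernel tau t : 0 < tau ->
  bounded_measurable (im_kernel tau t : T -> R).
Proof.
move=> tau0.
apply: (@continuous_bounded_measurable _ _ (im_kernel_bound tau t)) => [|x].
  exact: continuous_im_kernel.
exact: norm_im_kernel_le.
Qed.

Lemma charge_Rintegral_second_difference nu (k : R -> R -> R) t a :
  (forall s, bounded_measurable (k s : T -> R)) ->
  charge_Rintegral nu (fun x => second_difference (k ^~ x) t a)
  = second_difference (fun s => charge_Rintegral nu (k s)) t a.
Proof.
move=> bk; rewrite /second_difference.
have bD : bounded_measurable ((fun x => k (t + a) x + k (t - a) x) : T -> R).
  exact: bounded_measurableD.
rewrite charge_RintegralB//; last first.
  by under eq_fun do rewrite mulrC; exact: bounded_measurableZ.
congr (_ - _); under eq_fun do rewrite mulrC.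
by rewrite charge_RintegralZ// charge_RintegralD// mulrC.
Qed.

Lemma norm_second_difference_le (f : R -> R) t a e :
  `|f (t + a) - f t| <= e -> `|f (t - a) - f t| <= e ->
  `|second_difference f t a| <= e.
Proof.
rewrite !ler_norml /second_difference => /andP[? ?] /andP[? ?].
by apply/andP; split; lra.
Qed.

(** The drift t gamma is invisible to second differences, hence the modulation
    estimates hold whatever the values of the drift. *)
Lemma second_difference_affineD (c : R) (f : R -> R) t a :
  second_difference (fun s => s * c + f s) t a = second_difference f t a.
Proof. by rewrite /second_difference; field. Qed.

Lemma bounded_measurable_cosM (k : R -> R) a : bounded_measurable (k : T -> R) ->
  bounded_measurable ((fun x => k x * cos (a * x)) : T -> R).
Proof.
by move=> bk; apply: bounded_measurableM => //; exact: bounded_measurable_cosZ.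
Qed.

Lemma bounded_measurable_second_difference (k : R -> R -> R) t a :
  (forall s, bounded_measurable (k s : T -> R)) ->
  bounded_measurable ((fun x => second_difference (k ^~ x) t a) : T -> R).
Proof.
move=> bk; apply: bounded_measurableB => //.
under eq_fun do rewrite mulrC.
by apply: bounded_measurableZ; exact: bounded_measurableD.
Qed.

Lemma re_log_modulation nu t a :
  charge_Rintegral nu (fun x => re_kernel t x * cos (a * x)) - re_log nu t
  = second_difference (re_log nu) t a - second_difference (re_log nu) 0 a.
Proof.
have bk := bounded_measurable_re_kernel.
rewrite /re_log -charge_RintegralB//; last exact: bounded_measurable_cosM.
under eq_fun do rewrite re_kernel_cosM.
by rewrite charge_RintegralB ?charge_Rintegral_second_difference//;
  exact: bounded_measurable_second_difference.
Qed.

Lemma im_log_modulation tau nu t a : 0 < tau ->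
  charge_Rintegral nu (fun x => im_kernel tau t x * cos (a * x)) - im_log tau nu t
  = second_difference (im_log tau nu) t a
    - t / tau * second_difference (im_log tau nu) tau a.
Proof.
move=> tau0; have bk s := bounded_measurable_im_kernel s tau0.
rewrite /im_log -charge_RintegralB//; last exact: bounded_measurable_cosM.
under eq_fun do rewrite im_kernel_cosM ?gt_eqF//.
have bs s := bounded_measurable_second_difference s a bk.
rewrite charge_RintegralB//; last exact: bounded_measurableZ.
by rewrite charge_RintegralZ// !charge_Rintegral_second_difference.
Qed.

Lemma continuous_im_log tau nu : 0 < tau -> continuous (im_log tau nu).
Proof.
move=> tau0 t; apply/(@cvg_nbhsP _ R^o) => w wt.
have [N _ wN] : \forall n \near \oo, `|w n| <= `|t| + 1.
  move/cvgrPdist_le : wt => /(_ 1 ltr01); apply: filterS => n tw.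
  rewrite (_ : w n = t - (t - w n)); last by ring.
  by rewrite (le_trans (ler_normB _ _))// lerD.
rewrite -(cvg_shiftn N)/=.
apply: (@charge_Rintegral_cvg _ T R nu _ _ (im_kernel_bound tau (`|t| + 1))).
- by move=> n; have [] := bounded_measurable_im_kernel (w (n + N)%N) tau0.
- by have [] := bounded_measurable_im_kernel t tau0.
- move=> n x; apply: le_trans (norm_im_kernel_le _ _ tau0) _.
  have wt1 : `|w (n + N)%N| <= `|t| + 1 by apply: wN => /=; exact: leq_addl.
  have t10 : 0 <= `|t| + 1 by rewrite addr_ge0.
  rewrite /im_kernel_bound (ger0_norm t10).
  apply: lerD; first by rewrite ler_wpM2l// lerD// ler_wpM2r// invr_ge0 ltW.
  rewrite ler_wpM2r ?invr_ge0// lerD//; last by rewrite ler_wpM2r// sqr_ge0.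
  by rewrite lerXn2r// nnegrE.
- move=> x; rewrite /im_kernel; case: (x == 0); first exact: cvg_cst.
  have wt' : w (n + N)%N @[n --> \oo] --> t by rewrite cvg_shiftn.
  apply: cvgM; last exact: cvg_cst.
  apply: cvgB.
    apply: continuous_cvg; first exact: continuous_sin.
    by apply: cvgM; [exact: wt'|exact: cvg_cst].
  apply: cvgM; last exact: cvg_cst.
  by apply: cvgM; [exact: wt'|exact: cvg_cst].
Qed.

(** Equicontinuity of the logarithms makes their second differences small, and these
    are exactly the effects of modulating the kernels. *)
Lemma log_cvg tau (Fn : nat -> cumulativeBounded (0 : R) (1 : R)) F
    (gamman : nat -> R) (Gn : nat -> R -> R) (G : R -> R)
    (nun : nat -> {charge set T -> \bar R}) nu (K : R) (D : set R) :
  0 < tau -> weak_cvg Fn F ->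
  (forall n t, re_char (Fn n) t
    = expR (re_log (nun n) t) * cos (t * gamman n + im_log tau (nun n) t) /\
    im_char (Fn n) t
    = expR (re_log (nun n) t) * sin (t * gamman n + im_log tau (nun n) t)) ->
  (forall n, right_continuous (Gn n)) -> right_continuous G ->
  (forall n, (total_variation_line (Gn n) <= K%:E)%E) ->
  (total_variation_line G <= K%:E)%E ->
  (forall n, is_stieltjes_charge (Gn n) (nun n)) -> is_stieltjes_charge G nu ->
  countable D ->
  (forall x1 x2, ~ D x1 -> ~ D x2 ->
    Gn n x2 - Gn n x1 @[n --> \oo] --> G x2 - G x1) ->
  forall t, re_log (nun n) t @[n --> \oo] --> re_log nu t /\
    im_log tau (nun n) t @[n --> \oo] --> im_log tau nu t.
Proof.
move=> tau0 wF polar Gnrc Grc GnK GK nunG nuG cD Gcvg t.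
pose W n s := s * gamman n + im_log tau (nun n) s.
have eqc : forall e, 0 < e -> exists2 d, 0 < d & \forall n \near \oo,
    forall s a, `|s| <= `|t| + tau -> `|a| <= d ->
      `|re_log (nun n) (s + a) - re_log (nun n) s| <= e /\
      `|W n (s + a) - W n s| <= e.
  apply: (log_equicontinuous wF).
  - by move=> n s; have [] := polar n s.
  - by move=> n s; have [] := polar n s.
  - move=> n s; apply: cvgD; last exact: continuous_im_log.
    by apply: cvgM; [exact: cvg_id|exact: cvg_cst].
  - move=> L; exists (- (3 * K * (L ^+ 2 + 4))) => n s sL.
    have K0 : 0 <= K by rewrite -lee_fin (le_trans _ GK)// total_variation_line_ge0.
    have sL2 : s ^+ 2 <= L ^+ 2.
      by rewrite -real_normK ?num_real// lerXn2r// nnegrE// (le_trans _ sL).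
    rewrite lerNl (le_trans (ler_norm _))// normrN.
    apply: (charge_Rintegral_le_variation (Gnrc n) (GnK n) (nunG n)).
      exact: bounded_measurable_re_kernel.
    by move=> x; rewrite (le_trans (norm_re_kernel_le _ _))// lerD2r.
have tl : `|t| <= `|t| + tau by rewrite lerDl ltW.
have zl : `|0 : R| <= `|t| + tau by rewrite normr0 addr_ge0// ltW.
have taul : `|tau| <= `|t| + tau by rewrite gtr0_norm// lerDr.
split.
- apply: (modulation_charge_Rintegral_cvg Gnrc Grc GnK GK nunG nuG cD Gcvg
    (@continuous_re_kernel _ t) (norm_re_kernel_le t)) => e e0.
  have [d d0 Hd] := eqc _ (divr_gt0 e0 (ltr0n R 2)).
  exists d => //; apply: filterS Hd => n Hn a /andP[a0 ad].
  have ad1 : `|a| <= d by rewrite ger0_norm.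
  have ad2 : `|- a| <= d by rewrite normrN.
  rewrite -/(re_log _ _) re_log_modulation (splitr e).
  rewrite (le_trans (ler_normB _ _))// lerD//; apply: norm_second_difference_le.
  + by have [] := Hn t a tl ad1.
  + by have [] := Hn t (- a) tl ad2.
  + by have [] := Hn 0 a zl ad1.
  + by have [] := Hn 0 (- a) zl ad2.
- have ck : continuous (im_kernel tau t) by exact: continuous_im_kernel.
  have kM x : `|im_kernel tau t x| <= im_kernel_bound tau t.
    exact: norm_im_kernel_le.
  apply: (modulation_charge_Rintegral_cvg Gnrc Grc GnK GK nunG nuG cD Gcvg
    ck kM) => e e0.
  pose c := 1 + `|t| / tau.
  have c0 : 0 < c by rewrite ltr_pwDl// divr_ge0// ltW.
  have [d d0 Hd] := eqc _ (divr_gt0 e0 c0).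
  exists d => //; apply: filterS Hd => n Hn a /andP[a0 ad].
  have ad1 : `|a| <= d by rewrite ger0_norm.
  have ad2 : `|- a| <= d by rewrite normrN.
  have sdW s : `|s| <= `|t| + tau ->
      `|second_difference (im_log tau (nun n)) s a| <= e / c.
    move=> sl; rewrite -(second_difference_affineD (gamman n)).
    apply: norm_second_difference_le.
      by have [] := Hn s a sl ad1.
    by have [] := Hn s (- a) sl ad2.
  rewrite -/(im_log _ _ _) im_log_modulation//.
  rewrite (le_trans (ler_normB _ _))// (_ : e = e / c + `|t| / tau * (e / c)).
    rewrite lerD ?sdW// !normrM normfV (gtr0_norm tau0) ler_wpM2l ?sdW//.
    by rewrite divr_ge0// ltW.
  by rewrite -{1}[e / c]mul1r -mulrDl -/c mulrC divfK// gt_eqF.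
Qed.

End logarithm_convergence.

(** * Passage to subsequences *)

Section subsequences.
Context {R : realType}.
Implicit Types (phi psi : nat -> nat).

Lemma increasing_indices_ge phi : increasing_indices phi -> forall n, (n <= phi n)%N.
Proof.
by move=> iphi; elim=> [//|n IHn]; exact: leq_ltn_trans IHn (iphi _ _ (ltnSn n)).
Qed.

Lemma increasing_indices_comp phi psi : increasing_indices phi ->
  increasing_indices psi -> increasing_indices (phi \o psi).
Proof. by move=> iphi ipsi m n mn; exact/iphi/ipsi. Qed.

Lemma increasing_indices_cvg phi : increasing_indices phi -> phi n @[n --> \oo] --> \oo.
Proof.
move=> iphi A [N _ NA]; exists N => // n /= Nn; apply: NA => /=.
exact: leq_trans Nn (increasing_indices_ge iphi n).
Qed.

Lemma cvg_subseq_indices phi (u : nat -> R) (l : R) : increasing_indices phi ->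
  u n @[n --> \oo] --> l -> u (phi n) @[n --> \oo] --> l.
Proof. by move=> iphi ul; exact: (cvg_comp _ _ (increasing_indices_cvg iphi) ul). Qed.

Lemma cvg_from_subsequences (u : nat -> R) (l : R) :
  (forall phi, increasing_indices phi ->
    exists2 psi, increasing_indices psi & u (phi (psi n)) @[n --> \oo] --> l) ->
  u n @[n --> \oo] --> l.
Proof.
move=> H; apply/cvgrPdist_le => e e0; apply: contrapT => notcvg.
have next N : exists n, (N <= n)%N /\ e < `|l - u n|.
  apply: contrapT => none; apply: notcvg; exists N => // n /= Nn.
  by rewrite leNgt; apply/negP => en; apply: none; exists n.
have [f fP] := choice next.
pose phi := fix phi n := if n is m.+1 then f (phi m).+1 else f 0%N.
have phi_far n : e < `|l - u (phi n)| by case: n => [|n]; exact: (fP _).2.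
have phiS n : (phi n < phi n.+1)%N by exact: (fP _).1.
have iphi : increasing_indices phi by apply: homo_ltn => //; exact: ltn_trans.
have [psi _ /cvgrPdist_le /(_ _ e0) /filter_ex [n]] := H _ iphi.
by rewrite leNgt phi_far.
Qed.

Lemma eventually_bounded_of_limn_esup (u : nat -> \bar R) :
  (limn_esup u < +oo)%E ->
  exists K : R, exists N, forall n, (N <= n)%N -> (u n <= K%:E)%E.
Proof.
rewrite limn_esup_lim (cvg_lim _ (@cvg_esups_inf _ u))//.
move=> /ereal_inf_lt[_ [N _ <-]] uN.
have [K NK] : exists K : R, (esups u N <= K%:E)%E.
  case: (esups u N) uN => [r _|//|_]; first by exists r.
  by exists 0; exact: leNye.
exists K, N => n Nn; apply: le_trans NK; apply: ereal_sup_ubound.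
by exists n.
Qed.

End subsequences.

Theorem theorem7 (R : realType) (tau : R) (tau_gt0 : 0 < tau)
    (Fn : nat -> cumulativeBounded (0 : R) (1 : R))
    (gamman : nat -> R) (Gn : nat -> R -> R)
    (Fn_qid : forall n, quasi_infinitely_divisible tau (Fn n))
    (Fn_pair : forall n, spectral_pair tau (Fn n) (gamman n) (Gn n))
    (Gn_bounded : (limn_esup (fun n => total_variation_line (Gn n)) < +oo)%E)
    (Fn_rc : relatively_compact Fn)
    (gamma : R) (G : R -> R) (G_V : class_V G)
    (gamma_cvg : gamman n @[n --> \oo] --> gamma)
    (G_cvg : basic_cvg Gn G) :
  exists F : cumulativeBounded (0 : R) (1 : R),
    [/\ quasi_infinitely_divisible tau F, spectral_pair tau F gamma G
      & weak_cvg Fn F].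
Proof.
have [K0 [N GnK0]] := eventually_bounded_of_limn_esup Gn_bounded.
have [nu nuG] := stieltjes_charge_exists G_V.
have [Gfin Grc _] := G_V.
pose K := Num.max K0 (fine (total_variation_line G)).
have GK : (total_variation_line G <= K%:E)%E.
  have tv0 := total_variation_line_ge0 G.
  by rewrite -[leLHS]fineK ?ge0_fin_numE// lee_fin le_max lexx orbT.
have GnK n : (N <= n)%N -> (total_variation_line (Gn n) <= K%:E)%E.
  by move=> Nn; rewrite (le_trans (GnK0 n Nn))// lee_fin le_max lexx.
pose P F (nu' : {charge set (measurableTypeR R) -> \bar R}) g t :=
  re_char F t = expR (re_log nu' t) * cos (t * g + im_log tau nu' t) /\
  im_char F t = expR (re_log nu' t) * sin (t * g + im_log tau nu' t).
have exnun n : exists nu', is_stieltjes_charge (Gn n) nu' /\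
    forall t, P (Fn n) nu' (gamman n) t.
  by have /spectral_pairP [_ [nu' h1 h2]] := Fn_pair n; exists nu'.
pose nun n := projT1 (cid (exnun n)).
have nunP n : is_stieltjes_charge (Gn n) (nun n) /\
    forall t, P (Fn n) (nun n) (gamman n) t by exact: projT2 (cid (exnun n)).
(* Every subsequence has a weak limit along a further one, and that limit is
   bound to have the characteristic function given by gamma and G. *)
have sub phi : increasing_indices phi -> exists2 psi, increasing_indices psi &
    exists2 F, forall t, P F nu gamma t & weak_cvg (fun k => Fn (phi (psi k))) F.
  move=> iphi; pose phi1 k := phi (k + N)%N.
  have iphi1 : increasing_indices phi1 by move=> m n mn; apply: iphi; rewrite ltn_add2r.
  have [psi ipsi [F wF]] := Fn_rc _ iphi1.
  have [psi' ipsi' [D cD Dcvg]] := G_cvg _ (increasing_indices_comp iphi1 ipsi).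
  pose Phi k := phi1 (psi (psi' k)).
  have iPhi : increasing_indices Phi.
    by apply: (increasing_indices_comp iphi1); exact: increasing_indices_comp.
  have wF' : weak_cvg (fun k => Fn (Phi k)) F.
    by move=> h ch hM; exact: (cvg_subseq_indices ipsi' (wF h ch hM)).
  have PhiN k : (N <= Phi k)%N.
    apply: leq_trans (leq_addl (psi (psi' k)) N) _.
    exact: (increasing_indices_ge iphi).
  have logs := @log_cvg R tau (Fn \o Phi) F (gamman \o Phi) (Gn \o Phi) G
    (nun \o Phi) nu K D tau_gt0 wF' (fun n => (nunP _).2) _ Grc _ GK
    (fun n => (nunP _).1) nuG cD Dcvg.
  exists (fun k => psi (psi' k) + N)%N.
    by move=> m n mn; rewrite ltn_add2r; exact/ipsi/ipsi'.
  exists F; last exact: wF'.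
  move=> t.
  have [|k|cU cV] := logs _ _ t.
  - by move=> n; have [[]] := Fn_pair (Phi n).
  - exact: GnK.
  have cg : gamman (Phi k) @[k --> \oo] --> gamma by exact: cvg_subseq_indices.
  have cW : t * gamman (Phi k) + im_log tau (nun (Phi k)) t @[k --> \oo]
      --> t * gamma + im_log tau nu t.
    by apply: cvgD => //; apply: cvgM => //; exact: cvg_cst.
  have cE : expR (re_log (nun (Phi k)) t) @[k --> \oo] --> expR (re_log nu t).
    by apply: continuous_cvg => //; exact: continuous_expR.
  split.
  - have b1 : exists M, forall x, `|cos (t * x)| <= M by exists 1 => x; exact: cos_max.
    have h1 := wF' (fun x => cos (t * x)) (@continuous_cosZ _ t) b1.
    have h2 : re_char (Fn (Phi k)) t @[k --> \oo]
        --> expR (re_log nu t) * cos (t * gamma + im_log tau nu t).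
      under eq_fun do rewrite ((nunP _).2 t).1.
      by apply: cvgM => //; apply: continuous_cvg => //; exact: continuous_cos.
    exact: (cvg_unique _ h1 h2).
  - have b1 : exists M, forall x, `|sin (t * x)| <= M by exists 1 => x; exact: sin_max.
    have h1 := wF' (fun x => sin (t * x)) (@continuous_sinZ _ t) b1.
    have h2 : im_char (Fn (Phi k)) t @[k --> \oo]
        --> expR (re_log nu t) * sin (t * gamma + im_log tau nu t).
      under eq_fun do rewrite ((nunP _).2 t).2.
      by apply: cvgM => //; apply: continuous_cvg => //; exact: continuous_sin.
    exact: (cvg_unique _ h1 h2).
have [_ _ [F Fpair _]] := sub id (fun m n => id).
have GF : spectral_pair tau F gamma G.
  by apply/spectral_pairP; split=> //; exists nu.
exists F; split=> //; first by exists gamma, G.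
move=> h ch [M hM]; apply: cvg_from_subsequences => phi iphi.
have [psi ipsi [F' F'pair wF']] := sub _ iphi.
exists psi => //.
have charE t : re_char F t = re_char F' t /\ im_char F t = im_char F' t.
  by have [-> ->] := Fpair t; have [-> ->] := F'pair t.
rewrite (eq_char_Rintegral charE ch hM).
by apply: wF' => //; exists M.
Qed.
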